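(* Let $\mathsf{M}$ be a super-intuitionistic logic of infinite branching which has a Frege system. (i) Let $\mathsf{L}$ be a substructural logic with the language $\mathcal{L}^*=\{\wedge,\vee,*,\setminus,/,1,0\}$ such that $\mathsf{L}\subseteq^t\mathsf{M}$. Then the number of lines of every proof of $\Theta^*_n$ in $\mathsf{L}-\mathbf{F}$ is exponential in $n$, and every proof of $\Theta^*_n$ in $\mathsf{L}-\mathbf{EF}$ has length exponential in $n$. (ii) Let $\mathsf{L}$ be a super-basic logic with the language $\mathcal{L}=\{\wedge,\vee,\to,\top,\bot\}$ such that $\mathsf{L}\subseteq\mathsf{M}$. Then the number of lines of every proof of $(\Theta^*_n)^t$ in any $\mathsf{L}-\mathbf{F}$ system with respect to $\mathsf{M}$ is exponential in $n$, and every proof of $(\Theta^*_n)^t$ in any $\mathsf{L}-\mathbf{EF}$ system with respect to $\mathsf{M}$ has length exponential in $n$.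
   Context: **Convention.** ''Exponential in $n$'' means bounded below by $2^{n^{\Omega(1)}}$, i.e. there is $\varepsilon>0$ (depending on the systems but not on $n$) such that the quantity is at least $2^{n^{\varepsilon}}$ for all sufficiently large $n$. The length of a proof is its number of symbols. **Translation $t$** from $\mathcal{L}^*$-formulas to $\mathcal{L}$-formulas: $p^t=p$ for variables, $0^t=\bot$, $1^t=\top$, $(\phi\circ\psi)^t=\phi^t\circ\psi^t$ for $\circ\in\{\wedge,\vee\}$, $(\phi*\psi)^t=\phi^t\wedge\psi^t$, $(\psi/\phi)^t=(\phi\setminus\psi)^t=\phi^t\to\psi^t$. $\mathsf{L}\subseteq^t\mathsf{M}$ means $\phi^t\in\mathsf{M}$ for every $\phi\in\mathsf{L}$. **The calculus $\mathbf{FL}$** over $\mathcal{L}^*$. Sequents $\Gamma\Rightarrow\Delta$, with $\Gamma$ a finite sequence of formulas and $\Delta$ empty or a single formula. Initial sequents: $\phi\Rightarrow\phi$; $\Rightarrow 1$; $0\Rightarrow$. Rules (premises / conclusion): (cut) $\Gamma\Rightarrow\phi$ and $\Sigma,\phi,\Pi\Rightarrow\Delta$ / $\Sigma,\Gamma,\Pi\Rightarrow\Delta$; $(1w)$ $\Gamma,\Sigma\Rightarrow\Delta$ / $\Gamma,1,\Sigma\Rightarrow\Delta$; $(0w)$ $\Gamma\Rightarrow$ / $\Gamma\Rightarrow 0$; $(L\wedge)$ $\Gamma,\phi,\Sigma\Rightarrow\Delta$ (or $\Gamma,\psi,\Sigma\Rightarrow\Delta$) / $\Gamma,\phi\wedge\psi,\Sigma\Rightarrow\Delta$;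 $(R\wedge)$ $\Gamma\Rightarrow\phi$ and $\Gamma\Rightarrow\psi$ / $\Gamma\Rightarrow\phi\wedge\psi$; $(L\vee)$ $\Gamma,\phi,\Sigma\Rightarrow\Delta$ and $\Gamma,\psi,\Sigma\Rightarrow\Delta$ / $\Gamma,\phi\vee\psi,\Sigma\Rightarrow\Delta$; $(R\vee)$ $\Gamma\Rightarrow\phi$ (or $\Gamma\Rightarrow\psi$) / $\Gamma\Rightarrow\phi\vee\psi$; $(L* )$ $\Gamma,\phi,\psi,\Sigma\Rightarrow\Delta$ / $\Gamma,\phi*\psi,\Sigma\Rightarrow\Delta$; $(R* )$ $\Gamma\Rightarrow\phi$ and $\Sigma\Rightarrow\psi$ / $\Gamma,\Sigma\Rightarrow\phi*\psi$; $(L/)$ $\Gamma\Rightarrow\phi$ and $\Pi,\psi,\Sigma\Rightarrow\delta$ / $\Pi,\psi/\phi,\Gamma,\Sigma\Rightarrow\delta$; $(R/)$ $\Gamma,\phi\Rightarrow\psi$ / $\Gamma\Rightarrow\psi/\phi$; $(L\setminus)$ $\Gamma\Rightarrow\phi$ and $\Pi,\psi,\Sigma\Rightarrow\delta$ / $\Pi,\Gamma,\phi\setminus\psi,\Sigma\Rightarrow\delta$; $(R\setminus)$ $\phi,\Gamma\Rightarrow\psi$ / $\Gamma\Rightarrow\phi\setminus\psi$. **Substructural logics.** $\Upsilon\vdash_{\mathsf{FL}}\phi$ means $(\Rightarrow\phi)$ is provable in $\mathbf{FL}$ with the extra initial sequents $\Rightarrow\gamma$, $\gamma\in\Upsilon$;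 $\mathsf{FL}=\{\phi:\ \vdash_{\mathsf{FL}}\phi\}$. A set $\mathsf L$ of $\mathcal{L}^*$-formulas closed under substitution is a substructural logic if: $\mathsf{FL}\subseteq\mathsf{L}$; $\phi,\psi\in\mathsf{L}$ implies $\phi\wedge\psi\in\mathsf{L}$; $\phi,\phi\setminus\psi\in\mathsf{L}$ implies $\psi\in\mathsf{L}$; $\phi\in\mathsf{L}$ implies $\psi\setminus(\phi*\psi)\in\mathsf{L}$ and $(\psi*\phi)/\psi\in\mathsf{L}$ for every $\psi$. For such $\mathsf L$, $\Upsilon\vdash_{\mathsf L}\phi$ means $\Upsilon\cup\mathsf{L}\vdash_{\mathsf{FL}}\phi$. **The calculus $\mathbf{BPC}$** over $\mathcal{L}$. Sequents $\Upsilon\Rightarrow\Xi$ with $\Upsilon,\Xi$ finite multisets. Initial sequents: $\Upsilon,\phi\Rightarrow\phi,\Xi$; $\Upsilon\Rightarrow\top,\Xi$; $\Upsilon,\bot\Rightarrow\Xi$. Rules: $(L\wedge)$ $\phi,\psi,\Upsilon\Rightarrow\Xi$ / $\phi\wedge\psi,\Upsilon\Rightarrow\Xi$; $(R\wedge)$ $\Upsilon\Rightarrow\Xi,\phi$ and $\Upsilon\Rightarrow\Xi,\psi$ / $\Upsilon\Rightarrow\Xi,\phi\wedge\psi$; $(L\vee)$ $\phi,\Upsilon\Rightarrow\Xi$ and $\psi,\Upsilon\Rightarrow\Xi$ / $\phi\vee\psi,\Upsilon\Rightarrow\Xi$; $(R\vee)$ $\Upsilon\Rightarrow\Xi,\phi,\psi$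 / $\Upsilon\Rightarrow\Xi,\phi\vee\psi$; $(R\to)$ $\phi,\Upsilon\Rightarrow\psi$ / $\Upsilon\Rightarrow\Xi,\phi\to\psi$; $(D)$ $\phi\wedge\psi,\Upsilon\Rightarrow\Xi$ and $\phi\wedge\theta,\Upsilon\Rightarrow\Xi$ / $\phi\wedge(\psi\vee\theta),\Upsilon\Rightarrow\Xi$; $(Tr)$ $\Upsilon\Rightarrow\phi\to\psi$ and $\Upsilon\Rightarrow\psi\to\theta$ / $\Upsilon\Rightarrow\Xi,\phi\to\theta$; $(F\wedge)$ $\Upsilon\Rightarrow\phi\to\psi$ and $\Upsilon\Rightarrow\phi\to\theta$ / $\Upsilon\Rightarrow\Xi,\phi\to(\psi\wedge\theta)$; $(F\vee)$ $\Upsilon\Rightarrow\phi\to\theta$ and $\Upsilon\Rightarrow\psi\to\theta$ / $\Upsilon\Rightarrow\Xi,(\phi\vee\psi)\to\theta$; (cut) $\Upsilon_1\Rightarrow\phi,\Xi_1$ and $\Upsilon_2,\phi\Rightarrow\Xi_2$ / $\Upsilon_1,\Upsilon_2\Rightarrow\Xi_1,\Xi_2$. **Super-basic and super-intuitionistic logics.** A consequence relation $\vdash_{\mathsf L}$ is a relation between sets of formulas and formulas that is closed under substitution, reflexive ($\phi\in\Upsilon$ implies $\Upsilon\vdash_{\mathsf L}\phi$), transitive (if $\Upsilon\vdash_{\mathsf L}\phi$ and $\Xi\vdash_{\mathsf L}\gamma$ for all $\gamma\in\Upsilon$ then $\Xi\vdash_{\mathsf L}\phi$) and finitary; its logic is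 $\mathsf{L}=\{\phi:\ \vdash_{\mathsf L}\phi\}$. Over the language $\mathcal{L}$ it is super-basic (respectively super-intuitionistic) if it is closed under the initial sequents and rules of $\mathbf{BPC}$ (respectively of the standard intuitionistic sequent calculus $\mathbf{LJ}$), reading a sequent $\Upsilon\Rightarrow\Xi$ as $\Upsilon\vdash_{\mathsf L}\bigvee\Xi$ (empty disjunction $=\bot$): initial sequents hold, and if the premises of a rule instance hold so does its conclusion. Its logic is then called super-basic (super-intuitionistic). $\mathsf{T_k}$ is the super-intuitionistic logic axiomatized over intuitionistic logic by $\bigwedge_{i=0}^{k}\big((p_i\to\bigvee_{j\ne i}p_j)\to\bigvee_j p_j\big)\to\bigvee_i p_i$. A super-intuitionistic logic $\mathsf M$ has branching $k$ if $\mathsf{T_k}\subseteq\mathsf{M}$; it has infinite branching if it has branching $k$ for no $k$. **Frege systems.** An inference system is given by a set of rules $\phi_1,\dots,\phi_m\,/\,\phi$ ($m\ge 0$); a proof of $\phi$ from a set $X$ is a sequence of formulas (lines) ending in $\phi$, each in $X$ or derived from earlier ones by a substitution instance of a rule. For two substructural or two super-basic logics $\mathsf{L}\subseteq\mathsf{M}$, it is a Frege system for $\mathsf L$ with respect to $\mathsf M$ (an $\mathsf{L}-\mathbf{F}$ system wrt $\mathsf M$) if it has finitely many rules, is sound (provable formulas are in $\mathsf L$), strongly complete ($\phi_1,\dots,\phi_n\vdash_{\mathsf L}\phi$ implies $\phi$ is derivable from $\phi_1,\dots,\phi_n$), and every rule $\phi_1,\dots,\phi_m/\phi$ satisfies $\phi_1,\dots,\phi_m\vdash_{\mathsf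 M}\phi$. When $\mathsf M=\mathsf L$ it is called a Frege system for $\mathsf L$. An extended Frege system ($\mathsf{L}-\mathbf{EF}$, possibly wrt $\mathsf M$) is a Frege system together with the extension axiom: one may add a line $p\equiv\phi$, where $p$ is a variable not occurring in $\phi$, in any earlier line, in any hypothesis, or in the last line; here $p\equiv\phi$ is $(p\setminus\phi)\wedge(\phi\setminus p)$ in the substructural case and $(p\to\phi)\wedge(\phi\to p)$ in the super-basic case. For a substructural logic $\mathsf L$, $\mathsf{L}-\mathbf{F}$ and $\mathsf{L}-\mathbf{EF}$ denote any Frege, resp. extended Frege, system for $\mathsf L$ (unique up to a constant factor in the number of lines, resp. up to polynomial equivalence). **The formulas.** For $1\le k\le n$ use variables $p_{i,j},q_{i,j}$ ($0\le i,j<n$), $s_{i,l},s'_{i,l}$ ($0\le i<n$, $0\le l<k$), $r_{i,l},r'_{i,l}$ ($0\le i<n$, $0\le l<k+1$), and put $$\alpha^k_n(\bar p,\bar s,\bar s'):=\bigvee_{i<n}\bigwedge_{l<k}s'_{i,l}\ \vee\bigvee_{i,j<n}\bigvee_{l<k}(s_{i,l}\wedge s_{j,l}\wedge p_{i,j}),$$ $$\beta^{k+1}_n(\bar q,\bar r,\bar r'):=\bigvee_{l<k+1}\bigwedge_{i<n}r'_{i,l}\ \vee\bigvee_{i,j<n}\bigvee_{l<m<k+1}(r_{i,l}\wedge r_{j,m}\wedge q_{i,j}).$$ With $\bigotimes$ denoting iterated fusion $*$ in lexicographic order of the indices, $$\Theta^*_{n,k}:=\Big[\bigotimes_{i,j<n}((p_{i,j}\wedge1)\vee(q_{i,j}\wedge1))\Big]\setminus\Big(\Big[\bigotimes_{i<n,\,l<k}((s_{i,l}\wedge1)\vee(s'_{i,l}\wedge1))\setminus\alpha^k_n\Big]\vee\Big[\bigotimes_{i<n,\,l<k+1}((r_{i,l}\wedge1)\vee(r'_{i,l}\wedge1))\setminus\beta^{k+1}_n\Big]\Big),$$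 and $\Theta^*_n:=\Theta^*_{n,\lfloor\sqrt n\rfloor}$. *)

(* Defs.v *)
From Stdlib Require Import Reals List Permutation Arith.
Import ListNotations.

Set Implicit Arguments.

(* A countably infinite supply of propositional variables, which names the
   variables p_{i,j}, q_{i,j}, s_{i,l}, s'_{i,l}, r_{i,l}, r'_{i,l} directly;
   [vx i] are all the other ones. *)
Inductive var : Type :=
| vx (i : nat)
| vp (i j : nat)
| vq (i j : nat)
| vs (i l : nat)
| vs' (i l : nat)
| vr (i l : nat)
| vr' (i l : nat).

(* The iteration of [op], nested to the right; [e] is used only for the empty
   list, so that [bigop op e [x] = x]. *)
Fixpoint bigop (A : Type) (op : A -> A -> A) (e : A) (s : list A) : A :=
  match s with
  | [] => e
  | [x] => x
  | x :: s' => op x (bigop op e s')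
  end.

(** ** Formulas over {/\, \/, *, \, /, 1, 0} *)

Inductive sform : Type :=
| SVar (p : var)
| SOne
| SZero
| SAnd (phi psi : sform)
| SOr (phi psi : sform)
| SFus (phi psi : sform)
| SUnder (phi psi : sform)   (* phi \ psi *)
| SOver (psi phi : sform).   (* psi / phi *)

Fixpoint ssubst (sigma : var -> sform) (phi : sform) : sform :=
  match phi with
  | SVar p => sigma p
  | SOne => SOne
  | SZero => SZero
  | SAnd a b => SAnd (ssubst sigma a) (ssubst sigma b)
  | SOr a b => SOr (ssubst sigma a) (ssubst sigma b)
  | SFus a b => SFus (ssubst sigma a) (ssubst sigma b)
  | SUnder a b => SUnder (ssubst sigma a) (ssubst sigma b)
  | SOver a b => SOver (ssubst sigma a) (ssubst sigma b)
  end.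

Fixpoint soccurs (p : var) (phi : sform) : Prop :=
  match phi with
  | SVar q => p = q
  | SOne | SZero => False
  | SAnd a b | SOr a b | SFus a b | SUnder a b | SOver a b =>
      soccurs p a \/ soccurs p b
  end.

(* Every occurrence of a variable, constant or connective counts as one
   symbol; parentheses are not counted (as in prefix notation). *)
Fixpoint ssize (phi : sform) : nat :=
  match phi with
  | SVar _ | SOne | SZero => 1
  | SAnd a b | SOr a b | SFus a b | SUnder a b | SOver a b =>
      S (ssize a + ssize b)
  end.

(** ** Formulas over {/\, \/, ->, T, F} *)

Inductive lform : Type :=
| Var (p : var)
| Top
| Bot
| And (phi psi : lform)
| Or (phi psi : lform)
| Imp (phi psi : lform).

Fixpoint lsubst (sigma : var -> lform) (phi : lform) : lform :=
  match phi with
  | Var p => sigma p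
  | Top => Top
  | Bot => Bot
  | And a b => And (lsubst sigma a) (lsubst sigma b)
  | Or a b => Or (lsubst sigma a) (lsubst sigma b)
  | Imp a b => Imp (lsubst sigma a) (lsubst sigma b)
  end.

Fixpoint loccurs (p : var) (phi : lform) : Prop :=
  match phi with
  | Var q => p = q
  | Top | Bot => False
  | And a b | Or a b | Imp a b => loccurs p a \/ loccurs p b
  end.

Fixpoint lsize (phi : lform) : nat :=
  match phi with
  | Var _ | Top | Bot => 1
  | And a b | Or a b | Imp a b => S (lsize a + lsize b)
  end.

Fixpoint tr (phi : sform) : lform :=
  match phi with
  | SVar p => Var p
  | SOne => Top
  | SZero => Bot
  | SAnd a b => And (tr a) (tr b)
  | SOr a b => Or (tr a) (tr b)
  | SFus a b => And (tr a) (tr b)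
  | SUnder a b => Imp (tr a) (tr b)
  | SOver b a => Imp (tr a) (tr b)
  end.

(** ** What Frege systems need from a language *)

Record language : Type := Language {
  form : Type;
  fvar : var -> form;
  subst : (var -> form) -> form -> form;
  occurs : var -> form -> Prop;
  fsize : form -> nat;
  equiv : form -> form -> form   (* the connective of the extension axiom *)
}.

Definition Lstar : language :=
  Language SVar ssubst soccurs ssize
    (fun a b => SAnd (SUnder a b) (SUnder b a)).

Definition Lbasic : language :=
  Language Var lsubst loccurs lsize
    (fun a b => And (Imp a b) (Imp b a)).

(** ** Substructural logics *)

(* [FL X G d]: the sequent G => d is provable in FL with the extra initial
   sequents => gamma for gamma in X; [None] is the empty succedent. *)
Inductive FL (X : sform -> Prop) : list sform -> option sform -> Prop :=
| FL_extra phi : X phi -> FL X [] (Some phi)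
| FL_id phi : FL X [phi] (Some phi)
| FL_1 : FL X [] (Some SOne)
| FL_0 : FL X [SZero] None
| FL_cut G S P phi D :
    FL X G (Some phi) -> FL X (S ++ phi :: P) D -> FL X (S ++ G ++ P) D
| FL_1w G S D : FL X (G ++ S) D -> FL X (G ++ SOne :: S) D
| FL_0w G : FL X G None -> FL X G (Some SZero)
| FL_Land1 G S phi psi D :
    FL X (G ++ phi :: S) D -> FL X (G ++ SAnd phi psi :: S) D
| FL_Land2 G S phi psi D :
    FL X (G ++ psi :: S) D -> FL X (G ++ SAnd phi psi :: S) D
| FL_Rand G phi psi :
    FL X G (Some phi) -> FL X G (Some psi) -> FL X G (Some (SAnd phi psi))
| FL_Lor G S phi psi D :
    FL X (G ++ phi :: S) D -> FL X (G ++ psi :: S) D ->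
    FL X (G ++ SOr phi psi :: S) D
| FL_Ror1 G phi psi : FL X G (Some phi) -> FL X G (Some (SOr phi psi))
| FL_Ror2 G phi psi : FL X G (Some psi) -> FL X G (Some (SOr phi psi))
| FL_Lfus G S phi psi D :
    FL X (G ++ phi :: psi :: S) D -> FL X (G ++ SFus phi psi :: S) D
| FL_Rfus G S phi psi :
    FL X G (Some phi) -> FL X S (Some psi) ->
    FL X (G ++ S) (Some (SFus phi psi))
| FL_Lover G P S phi psi D :
    FL X G (Some phi) -> FL X (P ++ psi :: S) D ->
    FL X (P ++ SOver psi phi :: G ++ S) D
| FL_Rover G phi psi :
    FL X (G ++ [phi]) (Some psi) -> FL X G (Some (SOver psi phi))
| FL_Lunder G P S phi psi D :
    FL X G (Some phi) -> FL X (P ++ psi :: S) D ->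
    FL X (P ++ G ++ SUnder phi psi :: S) D
| FL_Runder G phi psi :
    FL X (phi :: G) (Some psi) -> FL X G (Some (SUnder phi psi)).

Definition FL_cons (X : sform -> Prop) (phi : sform) : Prop :=
  FL X [] (Some phi).

Record substructural (L : sform -> Prop) : Prop := {
  sub_subst : forall sigma phi, L phi -> L (ssubst sigma phi);
  sub_FL : forall phi, FL_cons (fun _ => False) phi -> L phi;
  sub_and : forall phi psi, L phi -> L psi -> L (SAnd phi psi);
  sub_mp : forall phi psi, L phi -> L (SUnder phi psi) -> L psi;
  sub_pn_under : forall phi psi, L phi -> L (SUnder psi (SFus phi psi));
  sub_pn_over : forall phi psi, L phi -> L (SOver (SFus psi phi) psi)
}.

Definition sub_cons (L X : sform -> Prop) (phi : sform) : Prop :=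
  FL_cons (fun psi => X psi \/ L psi) phi.

(** ** Sequent calculi over {/\, \/, ->, T, F} *)

(* Multisets are represented by lists, with an explicit rule of permutation. *)
Definition sequent : Type := (list lform * list lform)%type.

(* [BPC_rule ps c]: the premises ps and the conclusion c form an instance of a
   rule of BPC; initial sequents are the rules without premises. *)
Inductive BPC_rule : list sequent -> sequent -> Prop :=
| BPC_perm U U' X X' :
    Permutation U U' -> Permutation X X' -> BPC_rule [(U, X)] (U', X')
| BPC_id U X phi : BPC_rule [] (phi :: U, phi :: X)
| BPC_top U X : BPC_rule [] (U, Top :: X)
| BPC_bot U X : BPC_rule [] (Bot :: U, X)
| BPC_Land U X phi psi :
    BPC_rule [(phi :: psi :: U, X)] (And phi psi :: U, X)
| BPC_Rand U X phi psi :
    BPC_rule [(U, X ++ [phi]); (U, X ++ [psi])] (U, X ++ [And phi psi])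
| BPC_Lor U X phi psi :
    BPC_rule [(phi :: U, X); (psi :: U, X)] (Or phi psi :: U, X)
| BPC_Ror U X phi psi :
    BPC_rule [(U, X ++ [phi; psi])] (U, X ++ [Or phi psi])
| BPC_Rimp U X phi psi :
    BPC_rule [(phi :: U, [psi])] (U, X ++ [Imp phi psi])
| BPC_D U X phi psi theta :
    BPC_rule [(And phi psi :: U, X); (And phi theta :: U, X)]
             (And phi (Or psi theta) :: U, X)
| BPC_Tr U X phi psi theta :
    BPC_rule [(U, [Imp phi psi]); (U, [Imp psi theta])]
             (U, X ++ [Imp phi theta])
| BPC_Fand U X phi psi theta :
    BPC_rule [(U, [Imp phi psi]); (U, [Imp phi theta])]
             (U, X ++ [Imp phi (And psi theta)])
| BPC_For U X phi psi theta :
    BPC_rule [(U, [Imp phi theta]); (U, [Imp psi theta])]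
             (U, X ++ [Imp (Or phi psi) theta])
| BPC_cut U1 U2 X1 X2 phi :
    BPC_rule [(U1, phi :: X1); (U2 ++ [phi], X2)] (U1 ++ U2, X1 ++ X2).

Definition olist (D : option lform) : list lform :=
  match D with Some phi => [phi] | None => [] end.

(* LJ: antecedents are multisets, succedents have at most one formula. *)
Inductive LJ_rule : list sequent -> sequent -> Prop :=
| LJ_perm G G' D : Permutation G G' -> LJ_rule [(G, olist D)] (G', olist D)
| LJ_id phi : LJ_rule [] ([phi], [phi])
| LJ_top : LJ_rule [] ([], [Top])
| LJ_bot : LJ_rule [] ([Bot], [])
| LJ_Lw G phi D : LJ_rule [(G, olist D)] (phi :: G, olist D)
| LJ_Rw G phi : LJ_rule [(G, [])] (G, [phi])
| LJ_Lc G phi D : LJ_rule [(phi :: phi :: G, olist D)] (phi :: G, olist D)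
| LJ_Land1 G phi psi D : LJ_rule [(phi :: G, olist D)] (And phi psi :: G, olist D)
| LJ_Land2 G phi psi D : LJ_rule [(psi :: G, olist D)] (And phi psi :: G, olist D)
| LJ_Rand G phi psi : LJ_rule [(G, [phi]); (G, [psi])] (G, [And phi psi])
| LJ_Lor G phi psi D :
    LJ_rule [(phi :: G, olist D); (psi :: G, olist D)] (Or phi psi :: G, olist D)
| LJ_Ror1 G phi psi : LJ_rule [(G, [phi])] (G, [Or phi psi])
| LJ_Ror2 G phi psi : LJ_rule [(G, [psi])] (G, [Or phi psi])
| LJ_Limp G S phi psi D :
    LJ_rule [(G, [phi]); (psi :: S, olist D)] (Imp phi psi :: G ++ S, olist D)
| LJ_Rimp G phi psi : LJ_rule [(phi :: G, [psi])] (G, [Imp phi psi])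
| LJ_cut G S phi D :
    LJ_rule [(G, [phi]); (phi :: S, olist D)] (G ++ S, olist D).

(* [derivable R X s]: s is provable by the rules R with the extra initial
   sequents => gamma for gamma in X. *)
Inductive derivable (R : list sequent -> sequent -> Prop) (X : lform -> Prop)
  : sequent -> Prop :=
| der_extra phi : X phi -> derivable R X ([], [phi])
| der_rule ps c :
    R ps c -> (forall s, In s ps -> derivable R X s) -> derivable R X c.

(** ** Super-basic and super-intuitionistic logics *)

Definition lset (A : Type) (s : list A) : A -> Prop := fun x => In x s.

Definition image (A B : Type) (f : A -> B) (X : A -> Prop) : B -> Prop :=
  fun y => exists x, X x /\ y = f x.

Record consequence_relation (V : (lform -> Prop) -> lform -> Prop) : Prop := {
  cr_subst : forall sigma X phi,
    V X phi -> V (image (lsubst sigma) X) (lsubst sigma phi);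
  cr_refl : forall (X : lform -> Prop) phi, X phi -> V X phi;
  cr_trans : forall (X Y : lform -> Prop) phi,
    V X phi -> (forall gamma, X gamma -> V Y gamma) -> V Y phi;
  cr_finitary : forall (X : lform -> Prop) phi,
    V X phi ->
    exists s, (forall gamma, In gamma s -> X gamma) /\ V (lset s) phi
}.

Definition logic_of (V : (lform -> Prop) -> lform -> Prop) (phi : lform) : Prop :=
  V (fun _ => False) phi.

Definition holds (V : (lform -> Prop) -> lform -> Prop) (s : sequent) : Prop :=
  V (lset (fst s)) (bigop Or Bot (snd s)).

Definition closed_under (R : list sequent -> sequent -> Prop)
    (V : (lform -> Prop) -> lform -> Prop) : Prop :=
  forall ps c, R ps c -> (forall s, In s ps -> holds V s) -> holds V c.

Definition super_basic (V : (lform -> Prop) -> lform -> Prop) : Prop :=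
  consequence_relation V /\ closed_under BPC_rule V.

Definition super_intuitionistic (V : (lform -> Prop) -> lform -> Prop) : Prop :=
  consequence_relation V /\ closed_under LJ_rule V.

Definition Tk_axiom (k : nat) : lform :=
  let p i := Var (vx i) in
  let idx := seq 0 (k + 1) in
  let others i := filter (fun j => negb (Nat.eqb j i)) idx in
  let allp := bigop Or Bot (map p idx) in
  Imp (bigop And Top
         (map (fun i => Imp (Imp (p i) (bigop Or Bot (map p (others i)))) allp)
              idx))
      allp.

Definition Tk (k : nat) (phi : lform) : Prop :=
  derivable LJ_rule (fun g => exists sigma, g = lsubst sigma (Tk_axiom k))
    ([], [phi]).

Definition branching (k : nat) (V : (lform -> Prop) -> lform -> Prop) : Prop :=
  forall phi, Tk k phi -> logic_of V phi.

Definition infinite_branching (V : (lform -> Prop) -> lform -> Prop) : Prop :=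
  forall k, ~ branching k V.

(** ** Frege and extended Frege systems *)

Definition inference_system (F : language) : Type :=
  list (list (form F) * form F).

Definition by_rule (F : language) (P : inference_system F)
    (earlier : list (form F)) (psi : form F) : Prop :=
  exists prems concl (sigma : var -> form F),
    In (prems, concl) P /\ psi = subst F sigma concl /\
    forall chi, In chi prems -> In (subst F sigma chi) earlier.

Definition F_proof (F : language) (P : inference_system F)
    (X : form F -> Prop) (phi : form F) (pi : list (form F)) : Prop :=
  (exists pi0, pi = pi0 ++ [phi]) /\
  forall earlier psi later, pi = earlier ++ psi :: later ->
    X psi \/ by_rule P earlier psi.

Definition by_extension (F : language) (X : form F -> Prop) (phi : form F)
    (earlier : list (form F)) (psi : form F) : Prop :=
  exists (p : var) (chi : form F),
    psi = equiv F (fvar F p) chi /\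
    ~ occurs F p chi /\
    (forall gamma, In gamma earlier -> ~ occurs F p gamma) /\
    (forall gamma, X gamma -> ~ occurs F p gamma) /\
    ~ occurs F p phi.

Definition EF_proof (F : language) (P : inference_system F)
    (X : form F -> Prop) (phi : form F) (pi : list (form F)) : Prop :=
  (exists pi0, pi = pi0 ++ [phi]) /\
  forall earlier psi later, pi = earlier ++ psi :: later ->
    X psi \/ by_rule P earlier psi \/ by_extension F X phi earlier psi.

Definition num_lines (F : language) (pi : list (form F)) : nat := length pi.

Definition proof_length (F : language) (pi : list (form F)) : nat :=
  list_sum (map (fsize F) pi).

(* [frege_system L VL VM P]: P is a Frege system, with respect to the logic
   with consequence relation VM, for the logic L with consequence relation VL. *)
Definition frege_system (F : language) (L : form F -> Prop)
    (VL VM : (form F -> Prop) -> form F -> Prop) (P : inference_system F) : Prop :=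
  (forall phi pi, F_proof P (fun _ => False) phi pi -> L phi) /\
  (forall s phi, VL (lset s) phi -> exists pi, F_proof P (lset s) phi pi) /\
  (forall prems concl, In (prems, concl) P -> VM (lset prems) concl).

Definition sub_frege (L : sform -> Prop) (P : inference_system Lstar) : Prop :=
  @frege_system Lstar L (sub_cons L) (sub_cons L) P.

Definition basic_frege_wrt (VL VM : (lform -> Prop) -> lform -> Prop)
    (P : inference_system Lbasic) : Prop :=
  @frege_system Lbasic (logic_of VL) VL VM P.

Definition has_frege (V : (lform -> Prop) -> lform -> Prop) : Prop :=
  exists P, basic_frege_wrt V V P.

(** ** The formulas *)

Definition sor_big : list sform -> sform := bigop SOr SZero.
Definition sand_big : list sform -> sform := bigop SAnd SOne.
Definition fus_big : list sform -> sform := bigop SFus SOne.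

(* All pairs (i, j) with i < n and j < m, in lexicographic order. *)
Definition pairs (n m : nat) : list (nat * nat) :=
  list_prod (seq 0 n) (seq 0 m).

Definition alpha (n k : nat) : sform :=
  SOr
    (sor_big (map (fun i =>
       sand_big (map (fun l => SVar (vs' i l)) (seq 0 k))) (seq 0 n)))
    (sor_big (map (fun '(i, j) =>
       sor_big (map (fun l =>
         SAnd (SAnd (SVar (vs i l)) (SVar (vs j l))) (SVar (vp i j)))
         (seq 0 k))) (pairs n n))).

(* [beta n K] is beta^K_n. *)
Definition beta (n K : nat) : sform :=
  SOr
    (sor_big (map (fun l =>
       sand_big (map (fun i => SVar (vr' i l)) (seq 0 n))) (seq 0 K)))
    (sor_big (map (fun '(i, j) =>
       sor_big (map (fun '(l, m) =>
         SAnd (SAnd (SVar (vr i l)) (SVar (vr j m))) (SVar (vq i j)))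
         (filter (fun '(l, m) => Nat.ltb l m) (pairs K K)))) (pairs n n))).

Definition choice (x y : var) : sform :=
  SOr (SAnd (SVar x) SOne) (SAnd (SVar y) SOne).

Definition Theta2 (n k : nat) : sform :=
  SUnder
    (fus_big (map (fun '(i, j) => choice (vp i j) (vq i j)) (pairs n n)))
    (SOr
      (SUnder
        (fus_big (map (fun '(i, l) => choice (vs i l) (vs' i l)) (pairs n k)))
        (alpha n k))
      (SUnder
        (fus_big (map (fun '(i, l) => choice (vr i l) (vr' i l))
                      (pairs n (k + 1))))
        (beta n (k + 1)))).

Definition Theta (n : nat) : sform := Theta2 n (Nat.sqrt n).

(** ** Growth *)

(* The measure [m] of every proof of the n-th formula is at least 2^(n^eps),
   for some eps > 0 and all sufficiently large n; [prf n] is the set of proofs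
   of the n-th formula. *)
Definition exponential (A : Type) (prf : nat -> A -> Prop) (m : A -> nat) : Prop :=
  exists eps : R, (0 < eps)%R /\
  exists N : nat, forall n, N <= n ->
  forall pi, prf n pi -> (Rpower 2 (Rpower (INR n) eps) <= INR (m pi))%R.

(* Main.v *)
(** A consequence relation of infinite branching refutes, for every [k], an
    instance of the axiom of [T_k].  Adding to the premises as many formulas
    [V_i -> O \/ ~O] as possible, where [O] is the join of all [V_i /\ V_j] with
    [i <> j], one finds inside the Lindenbaum algebra of [M] a copy of the
    Heyting algebra of a large fork or of a large diamond, so that the finitely
    many rules of a Frege system are valid in that frame.

    Given a proof and a graph [a], let [S a] be the closure of what [a] says
    about the [p_ij] and [q_ij] under the leaf-level consequences between
    substituted subformulas of the rules used in the proof.  A Kleene slash relative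
    to [S a] makes every line of the proof slashed: rules are valid in the frame
    whose root is the slash and whose leaves are the points satisfying
    [S a].  Hence one of the two disjuncts of [Theta] lies in [S a], and since
    [S a] is a Horn closure, membership of the first disjunct is decided by a
    small monotone circuit, which separates cliques from complete partite
    graphs.  Razborov's theorem, in Jukna's version that approximates every gate
    both by a DNF and by a CNF, says that such circuits are exponentially large.

    Extension axioms cost nothing: substituting the definitions for the extension
    variables leaves the number of lines unchanged. *)

From Stdlib Require Import List Classical ClassicalEpsilon Arith Reals Lra.
From HB Require Import structures.
From mathcomp Require Import all_boot.
From mathcomp Require Import zify.
Require Import Defs.
Set Implicit Arguments. Unset Strict Implicit. Unset Printing Implicit Defensive.

(** * Monotone circuits separating cliques from complete partite graphs *)

(** The slash needs the graph described exactly, while Razborov's theorem needs a monotone circuit.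
    The antecedent of [Theta] is positive in the [p_ij] and [q_ij], so it is slashed as soon as it
    is true and its true subformulas lie in [S a]. There [q_ij] must say that [ij] is no edge, for
    only then does a [k+1]-clique refute the second disjunct. The first disjunct contains no [q_ij]:
    to decide it, all [q_ij] are made true, which leaves a circuit monotone in the edges that still
    rejects [k]-partite graphs.

    The size of the fork matters because every formula of a rule whose instance lies outside [S a]
    needs a leaf refuting it; infinite branching supplies more leaves than any rule has subformulas.
    Consequences are taken only among the subformulas of one rule instance, so the Horn rules number
    at most a constant times the number of lines.

    With [k] about the square root of [n], colours and blocks both number about [n ^ (1/2)] (a block
    having that many vertices). Terms and clauses of width about [n ^ (1/8)] leave ample room, and
    this is the source of the exponent [1/8]. *)

Definition graph := nat -> nat -> bool.

(* The gates of a monotone circuit, as the functions they compute, the last one first. *)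
Inductive program : seq (graph -> bool) -> Prop :=
| program_nil : program [::]
| program_edge i j fs : program fs -> program ((fun a => a i j) :: fs)
| program_const x fs : program fs -> program ((fun _ => x) :: fs)
| program_and f g fs : program fs -> List.In f fs -> List.In g fs ->
    program ((fun a => f a && g a) :: fs)
| program_or f g fs : program fs -> List.In f fs -> List.In g fs ->
    program ((fun a => f a || g a) :: fs).

Section LowerBound.
Variables (n K b k d : nat).
Hypotheses (Kb_n : K * b <= n) (d3 : 3 <= d) (d_b : 8 * d ^ 2 <= b)
  (d_k : 4 * d ^ 2 <= k).

(* The vertices below [K * b] form [K] blocks of size [b]; the positive tests are the
   cliques formed by one vertex [q l] of each block [l]. *)
Definition in_clique (q : 'I_b ^ K) (v : nat) : bool :=
  [exists l : 'I_K, v == l * b + q l].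

Definition clique_graph (q : 'I_b ^ K) : graph :=
  fun i j => [&& i != j, in_clique q i & in_clique q j].

Definition partite_graph (c : 'I_k ^ n) : graph := fun i j =>
  match insub i, insub j with Some u, Some v => c u != c v | _, _ => false end.

Definition covers (q : 'I_b ^ K) (X : {set 'I_n}) : bool :=
  [forall v in X, in_clique q v].

Definition edges := seq ('I_n * 'I_n).

(** This holds exactly when the clause [L], read as in [cross], rejects [partite_graph c]: pairs
    merged by [L] are then monochromatic, and otherwise some edge of [L] is itself a bichromatic
    merged pair. *)
Definition mono (c : 'I_k ^ n) (L : edges) : bool := all (fun e => c e.1 == c e.2) L.

(** Since [k >= 2], this is connectivity of [u] and [v] in the graph with edge list [L], expressed
    without paths. *)
Definition merges (L : edges) (u v : 'I_n) : bool :=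
  [forall c : 'I_k ^ n, mono c L ==> (c u == c v)].

(* A term [X] accepts the graphs in which [X] is a clique, a clause [L] those with an edge
   [u -- v] such that [merges L u v]; [cross L X] makes the term imply the clause. *)
Definition cross (L : edges) (X : {set 'I_n}) : bool :=
  [exists u in X, exists v in X, (u != v) && merges L u v].

Definition rainbow (c : 'I_k ^ n) (X : {set 'I_n}) : bool :=
  [forall u in X, forall v in X, (u != v) ==> (c u != c v)].


Lemma card_covers_aux m (X : {set 'I_n}) : #|X| = m -> #|[set q | covers q X]| * b ^ m <= b ^ K.
Proof.
elim: m X => [|m IH] X cX.
  by rewrite expn0 muln1 (leq_trans (max_card _)) // card_ffun !card_ord.
have [x xX] : exists x, x \in X by apply/card_gt0P; rewrite cX.
have cX' : #|X :\ x| = m by move: (cardsD1 x X); rewrite cX xX => -[].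
apply: leq_trans (IH _ cX'); rewrite expnS mulnA leq_mul2r; apply/orP; right.
have [q0 /= q0P|no] := pickP (mem [set q | covers q X]); last first.
  by rewrite (eq_card0 no) mul0n.
move: (q0P); rewrite inE => /forall_inP /(_ _ xX) /existsP [l /eqP xl].
pose upd (qh : ('I_b ^ K) * 'I_b) : 'I_b ^ K := [ffun i => if i == l then qh.2 else qh.1 i].
have loc q : covers q X -> q l = q0 l.
  move/forall_inP => /(_ _ xX) /existsP [l' /eqP xl'].
  have bpos : 0 < b by apply: leq_ltn_trans (ltn_ord (q l)).
  have E : l' = l.
    apply/val_inj => /=.
    have: (l' * b + q l') %/ b = (l * b + q0 l) %/ b by rewrite -xl -xl'.
    by rewrite !divnMDl // !divn_small ?addn0.
  by subst l'; apply/val_inj/eqP; rewrite -(eqn_add2l (l * b)) -xl -xl'.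
rewrite -[X in _ * X](card_ord b) -cardsT -cardsX -(@card_in_imset _ _ upd).
  apply: subset_leq_card; apply/subsetP => _ /imsetP [[q h] + ->].
  rewrite !inE andbT /= => qX; apply/forall_inP => v; rewrite !inE => /andP [vx vX].
  have /forall_inP /(_ _ vX) /existsP [i /eqP vi] := qX.
  apply/existsP; exists i; rewrite ffunE /=; case: (i =P l) => [il|_]; last exact/eqP.
  by subst i; case/eqP: vx; apply/ord_inj; rewrite vi xl loc.
move=> [q h] [q' h']; rewrite !inE !andbT /= => qX q'X /ffunP E.
have Eh : h = h' by have := E l; rewrite !ffunE eqxx.
congr (_, _) => //; apply/ffunP => i; have := E i; rewrite !ffunE /=.
by case: eqP => [->|//]; rewrite !loc.
Qed.

Lemma card_covers (X : {set 'I_n}) : #|[set q | covers q X]| * b ^ #|X| <= b ^ K.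
Proof. exact: card_covers_aux. Qed.

(* Recolouring the class of [u] by an arbitrary colour [h] is injective on colourings
   that identify the classes of [u] and [v]. *)
Lemma card_mono_cons L u v : ~~ merges L u v ->
  #|[set c | mono c ((u, v) :: L)]| * k <= #|[set c | mono c L]|.
Proof.
move=> nuv.
pose upd (ch : ('I_k ^ n) * 'I_k) : 'I_k ^ n :=
  [ffun w => if merges L u w then ch.2 else ch.1 w].
have muu : merges L u u by apply/forallP => c; apply/implyP.
rewrite -[X in _ * X](card_ord k) -cardsT -cardsX -(@card_in_imset _ _ upd).
  apply: subset_leq_card; apply/subsetP => _ /imsetP [[c h] + ->].
  rewrite !inE andbT /= => /andP [_ cL]; apply/allP => -[x y] xyL /=.
  have mxy c' : mono c' L -> c' x = c' y by move/allP => /(_ _ xyL) /eqP.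
  have -> : upd (c, h) x = upd (c, h) y; last by [].
  rewrite !ffunE /=; have -> : merges L u x = merges L u y.
    by apply/forallP/forallP => H c'; apply/implyP => m;
       have := implyP (H c') m; rewrite (mxy c' m).
  by case: ifP; rewrite // mxy.
move=> [c h] [c' h']; rewrite !inE !andbT /= => /andP [/eqP cuv cL] /andP [/eqP cuv' cL'] /ffunP E.
have Eh : h = h' by have := E u; rewrite !ffunE muu.
have Ev : c v = c' v by have := E v; rewrite !ffunE (negbTE nuv).
congr (_, _) => //; apply/ffunP => w; have := E w; rewrite !ffunE /=.
case: ifP => // /forallP m _.
by rewrite -(eqP (implyP (m c) cL)) -(eqP (implyP (m c') cL')) cuv cuv'.
Qed.


(** * Converting between CNFs and DNFs *)

Definition touched (L : edges) : seq 'I_n := map fst L ++ map snd L.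

(** An untouched vertex may be given a colour of its own. This leaves [cnf_to_dnf] at most
    [4 * d ^ 2] pairs to branch over. *)
Lemma merges_touched L u v : u != v -> merges L u v ->
  (u \in touched L) && (v \in touched L).
Proof.
have k2 : 1 < k by nia.
pose cc (w : 'I_n) : 'I_k ^ n :=
  [ffun x => if x == w then Ordinal k2 else Ordinal (ltnW k2)].
have tw w : w \notin touched L -> mono (cc w) L.
  rewrite mem_cat negb_or => /andP [n1 n2]; apply/allP => -[x y] xyL /=.
  rewrite !ffunE (_ : x == w = false) 1?(_ : y == w = false) //.
    by apply/eqP => yw; case/negP: n2; rewrite -yw; apply/mapP; exists (x, y).
  by apply/eqP => xw; case/negP: n1; rewrite -xw; apply/mapP; exists (x, y).
move=> uv /forallP m; apply/andP; split; apply/negPn/negP => /tw H.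
  by have := implyP (m _) H; rewrite !ffunE eqxx [v == u]eq_sym (negbTE uv).
by have := implyP (m _) H; rewrite !ffunE eqxx (negbTE uv).
Qed.

Lemma cross_sub L (X Y : {set 'I_n}) : X \subset Y -> cross L X -> cross L Y.
Proof.
move=> /subsetP sXY /exists_inP [u uX /exists_inP [v vX H]].
by apply/exists_inP; exists u; [exact: sXY|apply/exists_inP; exists v => //; exact: sXY].
Qed.

Definition clique_set (q : 'I_b ^ K) : {set 'I_n} := [set v : 'I_n | in_clique q v].

Lemma coversE q (X : {set 'I_n}) : covers q X = (X \subset clique_set q).
Proof.
apply/forall_inP/subsetP => H v vX; first by rewrite inE H.
by have := H v vX; rewrite inE.
Qed.

(** One branching step of both conversions below: [D] collects the finished terms or clauses, [E]
    the overlong ones, and only the latter are counted. *)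
Lemma gather (I : eqType) (A B T : Type) (pA : pred A) (pB : pred B)
    (cA : T -> pred A) (cB : T -> pred B) (R : T -> I -> bool) (ps : seq I) m :
  (forall i, i \in ps -> exists D E, [/\ all pA D, all pB E, size E <= m &
     forall t, R t i -> has (cA t) D || has (cB t) E]) ->
  exists D E, [/\ all pA D, all pB E, size E <= size ps * m &
     forall t, has (R t) ps -> has (cA t) D || has (cB t) E].
Proof.
elim: ps => [|i ps IH] H; first by exists [::], [::].
have [D1 [E1 [D1p E1p s1 c1]]] := H i (mem_head _ _).
have [|D2 [E2 [D2p E2p s2 c2]]] := IH.
  by move=> i' i'ps; apply: H; rewrite inE i'ps orbT.
exists (D1 ++ D2), (E1 ++ E2); rewrite !all_cat D1p D2p E1p E2p size_cat mulSn leq_add //.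
split=> // t /= /orP [/c1|/c2]; rewrite !has_cat => /orP [] ->; rewrite ?orbT //.
Qed.

(** A branching search from [X] with at most [j] further levels. A clique satisfying a clause that
    [X] does not cross contains two vertices touched by that clause, and these are added to [X]. A
    branch ends in [D] when [X] crosses every clause, and in [E] when [X] has reached [d]
    vertices. *)
Lemma cnf_to_dnf (C : seq edges) : all (fun L => size L < d) C ->
  forall j (X : {set 'I_n}), d <= #|X| + j ->
  exists D E : seq {set 'I_n},
  [/\ all (fun Y : {set 'I_n} => (#|Y| < d) && all (cross^~ Y) C) D,
      all (fun Y : {set 'I_n} => d <= #|Y|) E, size E <= (4 * d ^ 2) ^ j &
      forall q, covers q X && all (cross^~ (clique_set q)) C ->
        has (covers q) D || has (covers q) E].
Proof.
move=> Cs; elim=> [|j IH] X Xj.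
  exists [::], [:: X]; split=> //=; first by rewrite -[#|X|]addn0 Xj.
  by move=> q /andP [-> _].
have [Xd|Xd] := leqP d #|X|.
  exists [::], [:: X]; split=> //=; first by rewrite Xd.
    by rewrite expn_gt0; apply/orP; left; nia.
  by move=> q /andP [-> _].
case: (boolP (all (cross^~ X) C)) => [XC|/allPn [L LC XL]].
  exists [:: X], [::]; split=> //=; first by rewrite Xd XC.
  by move=> q /andP [-> _].
pose ps := [seq (u, v) | u <- touched L, v <- touched L].
(* Pairs inside [X] are dropped so that every branch gains a vertex; as [X] does not cross [L], no
   pair merged by [L] is lost. *)
pose ps' := [seq e <- ps | ~~ ((e.1 \in X) && (e.2 \in X))].
have [|D [E [Dp Ep sE H]]] := @gather _ _ _ ('I_b ^ K)
   (fun Y : {set 'I_n} => (#|Y| < d) && all (cross^~ Y) C)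
   (fun Y : {set 'I_n} => d <= #|Y|) covers covers
   (fun q e => covers q (X :|: [set e.1; e.2]) && all (cross^~ (clique_set q)) C)
   ps' ((4 * d ^ 2) ^ j).
  move=> e; rewrite mem_filter => /andP [eX _]; apply: IH.
  suff : #|X| < #|X :|: [set e.1; e.2]| by lia.
  apply: proper_card; rewrite properE subsetUl /=; apply: contra eX => /subsetP s.
  by rewrite !s ?inE ?eqxx ?orbT.
exists D, E; split=> //.
  apply: (leq_trans sE); rewrite [_ ^ j.+1]expnS leq_mul2r; apply/orP; right.
  rewrite size_filter; apply: (leq_trans (count_size _ _)).
  rewrite size_allpairs size_cat !size_map; have := allP Cs _ LC => /=; nia.
move=> q /andP [qX qC]; apply: H.
have /exists_inP [u uq /exists_inP [v vq /andP [uv m]]] := allP qC _ LC.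
have /andP [ut vt] := merges_touched uv m.
apply/hasP; exists (u, v).
  rewrite mem_filter allpairs_f // andbT /=; apply: contra XL => /andP [uX vX].
  by apply/exists_inP; exists u => //; apply/exists_inP; exists v => //; rewrite uv.
rewrite qC andbT coversE subUset -coversE qX /=; apply/subsetP => x.
by rewrite !inE => /orP [] /eqP ->; [move: uq|move: vq]; rewrite inE.
Qed.

(** The dual search, which grows a clause. A colouring that is not rainbow on a term [X] identifies
    two vertices of [X]. As [L] does not cross [X], they are not merged, so by [card_mono_cons] the
    new edge divides the number of monochromatic colourings by at least [k]; the bound with
    [k ^ size L] carries this count along. *)
Lemma dnf_to_cnf (D : seq {set 'I_n}) : all (fun X : {set 'I_n} => #|X| < d) D ->
  forall j (L : edges), d <= size L + j ->
  #|[set c | mono c L]| * k ^ size L <= k ^ n ->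
  exists C E : seq edges,
  [/\ all (fun L' => (size L' < d) && all (cross L') D) C,
      all (fun L' => #|[set c | mono c L']| * k ^ d <= k ^ n) E, size E <= (d ^ 2) ^ j &
      forall c, mono c L && all (fun X => ~~ rainbow c X) D ->
        has (mono c) C || has (mono c) E].
Proof.
have k0 : 0 < k by nia.
have d0 : 0 < d ^ 2 by nia.
move=> Ds; elim=> [|j IH] L Lj light.
  exists [::], [:: L]; split=> //=; last by move=> q /andP [-> _].
  rewrite andbT; apply: leq_trans light; rewrite leq_mul2l leq_pexp2l ?orbT //; lia.
have [Ld|Ld] := leqP d (size L).
  exists [::], [:: L]; split=> //=; last by move=> q /andP [-> _].
    by rewrite andbT; apply: leq_trans light; rewrite leq_mul2l leq_pexp2l ?orbT.
  by rewrite expn_gt0 d0.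
case: (boolP (all (cross L) D)) => [LD|/allPn [X XD LX]].
  exists [:: L], [::]; split=> //=; first by rewrite Ld LD.
  by move=> q /andP [-> _].
pose ps := [seq (u, v) | u <- enum X, v <- enum X].
pose ps' := [seq e <- ps | e.1 != e.2].
have [|C [E [Cp Ep sE H]]] := @gather _ _ _ ('I_k ^ n)
   (fun L' => (size L' < d) && all (cross L') D)
   (fun L' => #|[set c | mono c L']| * k ^ d <= k ^ n) mono mono
   (fun c e => mono c (e :: L) && all (fun X => ~~ rainbow c X) D)
   ps' ((d ^ 2) ^ j).
  move=> [u v]; rewrite mem_filter /= => /andP [uv /allpairsP [[u' v'] /= [u'X v'X [? ?]]]].
  subst u' v'; apply: (IH ((u, v) :: L)); first by rewrite /=; lia.
  rewrite /= expnS mulnA; apply: leq_trans light; rewrite leq_mul2r; apply/orP; right.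
  apply: card_mono_cons; apply: contra LX => m; apply/exists_inP; exists u.
    by rewrite -mem_enum.
  by apply/exists_inP; exists v; rewrite ?uv // -mem_enum.
exists C, E; split=> //.
  apply: (leq_trans sE); rewrite [_ ^ j.+1]expnS leq_mul2r; apply/orP; right.
  rewrite size_filter; apply: (leq_trans (count_size _ _)).
  rewrite size_allpairs -cardE; have := allP Ds _ XD => /=; nia.
move=> c /andP [cL cD]; apply: H.
have /forall_inPn [u uX /forall_inPn [v vX]] := allP cD _ XD.
rewrite negb_imply negbK => /andP [uv cuv].
apply/hasP; exists (u, v); last by rewrite cD andbT; apply/andP.
by rewrite mem_filter allpairs_f ?mem_enum // uv.
Qed.

(* The DNF [D] accepts the positive tests that [f] accepts, up to those accepted by [EP];
   the CNF [C] above it rejects the negative tests that [f] rejects, up to those rejected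
   by [EN]. *)
Definition approximable (EP : seq {set 'I_n}) (EN : seq edges) (f : graph -> bool) :=
  exists (D : seq {set 'I_n}) (C : seq edges),
  [/\ all (fun X : {set 'I_n} => #|X| < d) D, all (fun L => size L < d) C,
      all (fun L => all (cross L) D) C,
      forall q, ~~ has (covers q) EP -> f (clique_graph q) -> has (covers q) D &
      forall c, ~~ has (mono c) EN -> ~~ f (partite_graph c) -> has (mono c) C].

Lemma approximable_cat EP EN EP' EN' f :
  approximable EP EN f -> approximable (EP' ++ EP) (EN' ++ EN) f.
Proof.
move=> [D [C [Dd Cd DC p n']]]; exists D, C; split=> // [q|c].
  by rewrite has_cat negb_or => /andP [_]; exact: p.
by rewrite has_cat negb_or => /andP [_]; exact: n'.
Qed.

Lemma cross_clique q L D : all (cross L) D -> has (covers q) D -> cross L (clique_set q).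
Proof. by move=> /allP H /hasP [X /H HX]; rewrite coversE => /cross_sub; exact. Qed.

Lemma cross_rainbow c L X : cross L X -> mono c L -> ~~ rainbow c X.
Proof.
move=> /exists_inP [u uX /exists_inP [v vX /andP [uv /forallP m]]] cL.
apply/forall_inPn; exists u => //; apply/forall_inPn; exists v => //.
by rewrite negb_imply negbK uv (implyP (m c) cL).
Qed.

Lemma approximable_const EP EN x : approximable EP EN (fun=> x).
Proof.
case: x.
  exists [:: set0], [::]; split=> //=; first by rewrite cards0 (leq_trans _ d3).
  by move=> q _ _; rewrite coversE sub0set.
by exists [::], [:: [::]]; split=> //=; rewrite (leq_trans _ d3).
Qed.

Lemma approximable_ext EP EN f g :
  (forall q, f (clique_graph q) = g (clique_graph q)) ->
  (forall c, f (partite_graph c) = g (partite_graph c)) ->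
  approximable EP EN f -> approximable EP EN g.
Proof.
move=> e1 e2 [D [C [Dd Cd DC p n']]]; exists D, C; split=> // [q|c].
  by rewrite -e1; exact: p.
by rewrite -e2; exact: n'.
Qed.

Lemma in_clique_ltn q v : in_clique q v -> v < n.
Proof. by case/existsP => l /eqP ->; have := ltn_ord l; have := ltn_ord (q l); nia. Qed.

(** An input is at once a term and a clause, so it causes no error; a loop or an edge outside the
    vertex range is false on all tests. *)
Lemma approximable_edge EP EN i j : approximable EP EN (fun a : graph => a i j).
Proof.
have triv : (forall q, clique_graph q i j = false) ->
    (forall c, partite_graph c i j = false) -> approximable EP EN (fun a : graph => a i j).
  by move=> e1 e2; apply: (approximable_ext _ _ (approximable_const EP EN false)).
have [u iu ui|i_n] := insubP 'I_n i; last first.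
  apply: triv => [q|c]; last by rewrite /partite_graph insubN.
  by apply/negP => /and3P [_ /in_clique_ltn]; rewrite (negbTE i_n).
have [v jv vj|j_n] := insubP 'I_n j; last first.
  apply: triv => [q|c]; last by rewrite /partite_graph [insub j]insubN //; case: insub.
  by apply/negP => /and3P [_ _ /in_clique_ltn]; rewrite (negbTE j_n).
have [uv|uv] := eqVneq u v.
  have ij : i = j by rewrite -ui -vj uv.
  apply: triv => [q|c]; first by rewrite /clique_graph ij eqxx.
  by rewrite /partite_graph ij; case: insub => // ?; rewrite eqxx.
exists [:: [set u; v]], [:: [:: (u, v)]]; split=> /=.
- by rewrite cards2 uv (leq_trans _ d3).
- by rewrite (leq_trans _ d3).
- rewrite !andbT; apply/exists_inP; exists u; first by rewrite !inE eqxx.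
  apply/exists_inP; exists v; first by rewrite !inE eqxx orbT.
  by rewrite uv; apply/forallP => c; apply/implyP => /= /andP [].
- move=> q _ /and3P [_ iq jq]; rewrite orbF coversE; apply/subsetP => x.
  by rewrite !inE => /orP [] /eqP ->; [rewrite ui|rewrite vj].
- by move=> c _; rewrite /partite_graph -ui -vj !valK negbK => ->.
Qed.

(** A conjunction of CNFs is a CNF, so negative tests cost nothing. The DNF is rebuilt from the
    joined CNF, and the overlong terms become the new positive errors. Disjunctions are dual. *)
Lemma approximable_and EP EN f g :
  approximable EP EN f -> approximable EP EN g ->
  exists EP', [/\ all (fun Y : {set 'I_n} => d <= #|Y|) EP', size EP' <= (4 * d ^ 2) ^ d &
    approximable (EP' ++ EP) EN (fun a => f a && g a)].
Proof.
move=> [D1 [C1 [D1d C1d DC1 p1 n1]]] [D2 [C2 [D2d C2d DC2 p2 n2]]].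
have [||D [E [Dp Ep sE H]]] := @cnf_to_dnf (C1 ++ C2) _ d set0.
- by rewrite all_cat C1d.
- by rewrite cards0.
exists E; split=> //; exists D, (C1 ++ C2); split.
- by apply: sub_all Dp => Y /andP [].
- by rewrite all_cat C1d.
- apply/allP => L LC; apply/allP => Y YD.
  by have /andP [_ /allP] := allP Dp _ YD; exact.
- move=> q; rewrite has_cat negb_or => /andP [nE nEP] /andP [fq gq].
  have := H q; rewrite (negbTE nE) orbF; apply; rewrite coversE sub0set /=.
  apply/allP => L; rewrite mem_cat => /orP [LC|LC].
    by apply: cross_clique (p1 _ nEP fq); exact: (allP DC1).
  by apply: cross_clique (p2 _ nEP gq); exact: (allP DC2).
- move=> c nEN; rewrite negb_and has_cat => /orP [/(n1 _ nEN)|/(n2 _ nEN)] -> //.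
  by rewrite orbT.
Qed.

Lemma approximable_or EP EN f g :
  approximable EP EN f -> approximable EP EN g ->
  exists EN', [/\ all (fun L => #|[set c | mono c L]| * k ^ d <= k ^ n) EN',
    size EN' <= (d ^ 2) ^ d & approximable EP (EN' ++ EN) (fun a => f a || g a)].
Proof.
move=> [D1 [C1 [D1d C1d DC1 p1 n1]]] [D2 [C2 [D2d C2d DC2 p2 n2]]].
have [|||C [E [Cp Ep sE H]]] := @dnf_to_cnf (D1 ++ D2) _ d [::].
- by rewrite all_cat D1d.
- by [].
- by rewrite muln1 (leq_trans (max_card _)) // card_ffun !card_ord.
exists E; split=> //; exists (D1 ++ D2), C; split.
- by rewrite all_cat D1d.
- by apply: sub_all Cp => L /andP [].
- by apply: sub_all Cp => L /andP [].
- move=> q nEP; rewrite has_cat => /orP [/(p1 _ nEP)|/(p2 _ nEP)] -> //.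
  by rewrite orbT.
- move=> c; rewrite has_cat !negb_or => /andP [nE nEN] /andP [fc gc].
  have := H c; rewrite (negbTE nE) orbF; apply => /=.
  have /hasP [L1 L1C cL1] := n1 _ nEN fc; have /hasP [L2 L2C cL2] := n2 _ nEN gc.
  apply/allP => X; rewrite mem_cat => /orP [XD|XD].
    by apply: cross_rainbow cL1; exact: (allP (allP DC1 _ L1C)).
  by apply: cross_rainbow cL2; exact: (allP (allP DC2 _ L2C)).
Qed.

Lemma approximable_program gs : program gs -> exists EP EN,
  [/\ all (fun Y : {set 'I_n} => d <= #|Y|) EP,
      all (fun L => #|[set c | mono c L]| * k ^ d <= k ^ n) EN,
      size EP <= size gs * (4 * d ^ 2) ^ d, size EN <= size gs * (d ^ 2) ^ d &
      forall f, List.In f gs -> approximable EP EN f].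
Proof.
have aux (EP EP' : seq {set 'I_n}) (EN EN' : seq edges) (fs : seq (graph -> bool)) h :
  [/\ all (fun Y : {set 'I_n} => d <= #|Y|) EP,
      all (fun L => #|[set c | mono c L]| * k ^ d <= k ^ n) EN,
      size EP <= size fs * (4 * d ^ 2) ^ d, size EN <= size fs * (d ^ 2) ^ d &
      forall f, List.In f fs -> approximable EP EN f] ->
  all (fun Y : {set 'I_n} => d <= #|Y|) EP' ->
  all (fun L => #|[set c | mono c L]| * k ^ d <= k ^ n) EN' ->
  size EP' <= (4 * d ^ 2) ^ d -> size EN' <= (d ^ 2) ^ d ->
  approximable (EP' ++ EP) (EN' ++ EN) h ->
  exists EP EN,
  [/\ all (fun Y : {set 'I_n} => d <= #|Y|) EP,
      all (fun L => #|[set c | mono c L]| * k ^ d <= k ^ n) EN,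
      size EP <= size (h :: fs) * (4 * d ^ 2) ^ d, size EN <= size (h :: fs) * (d ^ 2) ^ d &
      forall f, List.In f (h :: fs) -> approximable EP EN f].
  move=> [a1 a2 s1 s2 H] a1' a2' s1' s2' Hh; exists (EP' ++ EP), (EN' ++ EN).
  rewrite !all_cat a1 a1' a2 a2' !size_cat /= !mulSn !leq_add //; split=> // f [<- //|/H].
  exact: approximable_cat.
elim=> [|i j fs' _|x fs' _|f g fs' _|f g fs' _].
- by exists [::], [::].
- move=> [EP [EN H]]; apply: (@aux EP [::] EN [::]) => //; exact: approximable_edge.
- move=> [EP [EN H]]; apply: (@aux EP [::] EN [::]) => //; exact: approximable_const.
- move=> [EP [EN H]] ff gf; have [_ _ _ _ A] := H.
  have [EP' [? ? ?]] := approximable_and (A _ ff) (A _ gf).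
  exact: (@aux EP EP' EN [::]).
- move=> [EP [EN H]] ff gf; have [_ _ _ _ A] := H.
  have [EN' [? ? ?]] := approximable_or (A _ ff) (A _ gf).
  exact: (@aux EP [::] EN EN').
Qed.

Lemma union_bound (T : finType) (A : eqType) (l : seq A) (P : T -> A -> bool) w z
    (S : {set T}) :
  (forall x, x \in S -> has (P x) l) ->
  all (fun e => #|[set x | P x e]| * w <= z) l -> #|S| * w <= size l * z.
Proof.
elim: l S => [|e l IH] S HS /=.
  move=> _; rewrite (_ : S = set0) ?cards0 //.
  by apply/setP => x; rewrite inE; apply/negP => /HS.
case/andP => ez lz; rewrite -(cardsID [set x | P x e] S) mulnDl mulSn leq_add //.
  by apply: leq_trans ez; rewrite leq_mul2r subset_leq_card ?orbT // subsetIr.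
apply: IH lz => x; rewrite !inE => /andP [nP /HS /=]; by rewrite (negbTE nP).
Qed.

(** The approximator of [f] errs often. If its DNF is empty, every clique is an error, while an
    overlong term covers at most a fraction [1 / b ^ d] of the cliques. Otherwise some term [X] with
    fewer than [d] vertices accepts all colourings rainbow on [X], which are at least three quarters
    of all since [4 * d ^ 2 <= k], while an overlong clause rejects at most a fraction
    [1 / k ^ d]. *)
Theorem clique_colouring_lower_bound fs f : program fs -> List.In f fs ->
  (forall q, f (clique_graph q)) -> (forall c, ~~ f (partite_graph c)) ->
  2 ^ d <= size fs.
Proof.
move=> /approximable_program [EP [EN [EPd ENd sEP sEN A]]] ffs fP fN.
have [D [C [Dd Cd DC p n']]] := A f ffs.
have d0 : 0 < d ^ 2 by nia.
have b0 : 0 < b by nia.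
have k0 : 0 < k by nia.
case: D Dd DC p => [|X D] Dd DC p.
  have H : #|[set: 'I_b ^ K]| * b ^ d <= size EP * b ^ K.
    apply: (@union_bound _ _ _ covers) => [q _|].
      by apply/negPn/negP => nq; have := p q nq (fP q).
    apply/allP => Y YEP; apply: leq_trans (card_covers Y); rewrite leq_mul2l.
    by rewrite leq_pexp2l ?orbT // (allP EPd).
  move: H; rewrite cardsT card_ffun !card_ord mulnC leq_pmul2r ?expn_gt0 ?b0 // => H.
  have : (2 * (4 * d ^ 2)) ^ d <= size fs * (4 * d ^ 2) ^ d.
    apply: leq_trans (leq_trans H sEP); rewrite leq_exp2r ?(leq_trans _ d3) // mulnA; exact: d_b.
  by rewrite expnMn leq_pmul2r // expn_gt0 muln_gt0 d0.
pose S1 := [set c | ~~ rainbow c X].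
have Xd : #|X| < d by case/andP: Dd.
have H1 : #|S1| * k <= d ^ 2 * k ^ n.
  pose ps := [seq e <- [seq (u, v) | u <- enum X, v <- enum X] | e.1 != e.2].
  have : #|S1| * k <= size ps * k ^ n.
    apply: (@union_bound _ _ _ (fun c e => mono c [:: e])) => [c|].
      rewrite inE => /forall_inPn [u uX /forall_inPn [v vX]].
      rewrite negb_imply negbK => /andP [uv cuv].
      apply/hasP; exists (u, v); last by rewrite /= cuv.
      by rewrite mem_filter allpairs_f ?mem_enum // uv.
    apply/allP => -[u v]; rewrite mem_filter => /andP [/= uv _].
    have : #|[set c | mono c [:: (u, v)]]| * k <= #|[set c | mono c [::]]|.
      by apply: card_mono_cons; apply/negP => /(merges_touched uv).
    move=> /leq_trans; apply.
    by rewrite (leq_trans (max_card _)) // card_ffun !card_ord.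
  move=> /leq_trans; apply; rewrite leq_mul2r; apply/orP; right.
  rewrite size_filter; apply: (leq_trans (count_size _ _)).
  by rewrite size_allpairs -cardE; nia.
(* Every clause of [C] is crossed by [X], hence rejects no colouring rainbow on [X]; each such
   colouring must be an error in [EN]. *)
have H2 : #|~: S1| * k ^ d <= size EN * k ^ n.
  apply: (@union_bound _ _ _ mono) ENd => c; rewrite !inE negbK => rX.
  apply/negPn/negP => nc; have /hasP [L LC cL] := n' c nc (fN c).
  have /andP [XL _] := allP DC _ LC.
  by have := cross_rainbow XL cL; rewrite rX.
have H3 : #|S1| + #|~: S1| = k ^ n by rewrite cardsC card_ffun !card_ord.
have kn0 : 0 < k ^ n by rewrite expn_gt0 k0.
have H4 : 4 * #|S1| <= k ^ n by nia.
have H5 : #|~: S1| * (4 * d ^ 2) ^ d <= size fs * (d ^ 2) ^ d * k ^ n.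
  apply: (@leq_trans (#|~: S1| * k ^ d)); first by rewrite leq_mul2l leq_exp2r ?(leq_trans _ d3) // d_k orbT.
  by apply: (leq_trans H2); rewrite leq_mul2r sEN orbT.
have H6 : #|~: S1| * 4 ^ d <= size fs * k ^ n.
  have dd0 : 0 < (d ^ 2) ^ d by rewrite expn_gt0 d0.
  by rewrite -(leq_pmul2r dd0) -mulnA -expnMn; move: H5; lia.
have H7 : 3 * 4 ^ d <= 4 * size fs by rewrite -(leq_pmul2r kn0); nia.
have : 2 ^ d * 2 <= 4 ^ d.
  by rewrite -[4]/(2 ^ 2) -expnM -expnSr leq_exp2l //; lia.
lia.
Qed.

End LowerBound.

(** * Circuits for Horn closures *)

Lemma In_mem (T : eqType) (x : T) s : List.In x s <-> x \in s.
Proof.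
elim: s => //= y s IH; rewrite inE IH; split=> [[->|->]|/orP [/eqP ->|->]];
  rewrite ?eqxx ?orbT; by [|left|right].
Qed.

(* [gs] is any program already containing [fs], so that costs add up. *)
Definition computes z (fs : seq (graph -> bool)) (f : graph -> bool) :=
  forall gs, program gs -> List.incl fs gs -> exists hs,
  [/\ program hs, List.incl gs hs, size hs <= size gs + z & exists2 g, List.In g hs & g =1 f].

Lemma computes_ext z fs f g : f =1 g -> computes z fs f -> computes z fs g.
Proof.
move=> fg H gs g1 g2; have [hs [h1 h2 h3 [h h4 h5]]] := H gs g1 g2.
by exists hs; split=> //; exists h => // a; rewrite h5.
Qed.

Lemma computes_le z z' fs f : z <= z' -> computes z fs f -> computes z' fs f.
Proof.
move=> zz H gs g1 g2; have [hs [h1 h2 h3 h4]] := H gs g1 g2.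
by exists hs; split=> //; apply: leq_trans h3 _; rewrite leq_add2l.
Qed.

Lemma computes_mem fs f : (exists2 g, List.In g fs & g =1 f) -> computes 0 fs f.
Proof.
move=> [g gfs gf] gs g1 g2; exists gs; split=> //; first by rewrite addn0.
by exists g => //; exact: g2.
Qed.

Lemma computes_const x fs : computes 1 fs (fun=> x).
Proof.
move=> gs g1 g2; exists ((fun=> x) :: gs); split; first exact: program_const.
- by move=> g; right.
- by rewrite /= addn1.
- by exists (fun=> x) => //; left.
Qed.

Lemma computes_edge i j fs : computes 1 fs (fun a => a i j).
Proof.
move=> gs g1 g2; exists ((fun a => a i j) :: gs); split; first exact: program_edge.
- by move=> g; right.
- by rewrite /= addn1.
- by exists (fun a => a i j) => //; left.
Qed.

Lemma computes_op (op : bool -> bool -> bool) z1 z2 fs f1 f2 :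
  (forall g1 g2 gs, program gs -> List.In g1 gs -> List.In g2 gs ->
    program ((fun a => op (g1 a) (g2 a)) :: gs)) ->
  computes z1 fs f1 -> computes z2 fs f2 ->
  computes (z1 + z2).+1 fs (fun a => op (f1 a) (f2 a)).
Proof.
move=> Hop H1 H2 gs gg fg.
have [hs [gh gsh s1 [h1 h1i h1e]]] := H1 gs gg fg.
have [|ks [gk hk s2 [h2 h2i h2e]]] := H2 hs gh; first by move=> ? /fg /gsh.
exists ((fun a => op (h1 a) (h2 a)) :: ks); split.
- by apply: Hop => //; exact: hk.
- by move=> x /gsh /hk; right.
- by rewrite /=; lia.
- by exists (fun a => op (h1 a) (h2 a)); [left|move=> a; rewrite h1e h2e].
Qed.

Lemma computes_and z1 z2 fs f1 f2 : computes z1 fs f1 -> computes z2 fs f2 ->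
  computes (z1 + z2).+1 fs (fun a => f1 a && f2 a).
Proof. by apply: computes_op => *; exact: program_and. Qed.

Lemma computes_or z1 z2 fs f1 f2 : computes z1 fs f1 -> computes z2 fs f2 ->
  computes (z1 + z2).+1 fs (fun a => f1 a || f2 a).
Proof. by apply: computes_op => *; exact: program_or. Qed.

Lemma computes_has (I : eqType) z fs (f : graph -> I -> bool) (l : seq I) :
  (forall i, i \in l -> computes z fs (f^~ i)) ->
  computes (size l * z.+1).+1 fs (fun a => has (f a) l).
Proof.
elim: l => [|i l IH] H /=; first exact: computes_const.
apply: (@computes_le (z + (size l * z.+1).+1).+1); first by lia.
apply: computes_or; first by apply: H; rewrite mem_head.
by apply: IH => j jl; apply: H; rewrite inE jl orbT.
Qed.

Lemma computes_all (I : eqType) z fs (f : graph -> I -> bool) (l : seq I) :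
  (forall i, i \in l -> computes z fs (f^~ i)) ->
  computes (size l * z.+1).+1 fs (fun a => all (f a) l).
Proof.
elim: l => [|i l IH] H /=; first exact: computes_const.
apply: (@computes_le (z + (size l * z.+1).+1).+1); first by lia.
apply: computes_and; first by apply: H; rewrite mem_head.
by apply: IH => j jl; apply: H; rewrite inE jl orbT.
Qed.

Lemma computes_list (I : eqType) z fs (f : I -> graph -> bool) (l : seq I) gs :
  (forall i, i \in l -> computes z fs (f i)) -> program gs -> List.incl fs gs ->
  exists hs, [/\ program hs, List.incl gs hs, size hs <= size gs + size l * z &
    forall i, i \in l -> exists2 g, List.In g hs & g =1 f i].
Proof.
elim: l gs => [|i l IH] gs H g1 g2.
  by exists gs; rewrite addn0; split=> // ?.
have [hs [h1 h2 h3 [g gh gf]]] := H i (mem_head _ _) gs g1 g2.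
have [||ks [k1 k2 k3 k4]] := IH hs _ h1.
- by move=> j jl; apply: H; rewrite inE jl orbT.
- by move=> x /g2 /h2.
exists ks; split=> //; [by move=> x /h2 /k2|by rewrite /=; lia|].
move=> j; rewrite inE => /orP [/eqP ->|/k4 //].
by exists g => //; exact: k2.
Qed.

Inductive horn (F : Type) (R : seq (seq F * F)) (init : F -> Prop) : F -> Prop :=
| horn_init phi : init phi -> horn R init phi
| horn_step X phi : List.In (X, phi) R ->
    (forall psi, List.In psi X -> horn R init psi) -> horn R init phi.

Lemma horn_mono (F : Type) (R : seq (seq F * F)) (P Q : F -> Prop) phi :
  (forall psi, P psi -> Q psi) -> horn R P phi -> horn R Q phi.
Proof.
move=> PQ; elim=> {phi} [phi /PQ|X phi XR _ IH]; first exact: horn_init.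
exact: horn_step XR IH.
Qed.

Section Horn.
Variables (F : eqType) (L0 : seq F) (init : graph -> F -> bool) (R : seq (seq F * F)).
Variables (z0 w : nat).
Hypotheses (init_L0 : forall a phi, init a phi -> phi \in L0)
  (init_z : forall phi, phi \in L0 -> computes z0 [::] (init^~ phi))
  (R_w : all (fun r => size r.1 <= w) R).

Let nodes := L0 ++ map snd R.
Let m := size nodes.
Let node (i : 'I_m) : F := tnth (in_tuple nodes) i.

Let fires (X : {set 'I_m}) (i : 'I_m) (r : seq F * F) :=
  (r.2 == node i) && all (fun psi => has (fun j => (node j == psi) && (j \in X)) (enum 'I_m)) r.1.

Let step (a : graph) (X : {set 'I_m}) : {set 'I_m} :=
  [set i | init a (node i) || has (fires X i) R].

Let node_surj phi : phi \in nodes -> exists i, node i = phi.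
Proof.
move=> phin; have H : index phi nodes < m by rewrite index_mem.
by exists (Ordinal H); rewrite /node (tnth_nth phi) /= nth_index.
Qed.


Let init_computes i : computes z0.+1 [::] (init^~ (node i)).
Proof.
case: (boolP (node i \in L0)) => [/init_z H|nL0]; first exact: computes_le (leqnSn z0) H.
apply: (@computes_ext _ _ (fun=> false)); last first.
  exact: computes_le (ltn0Sn z0) (@computes_const _ _).
by move=> a; apply/esym/negbTE; apply: contra nL0; exact: init_L0.
Qed.

Definition horn_cost :=
  1 + size (L0 ++ map snd R) * (size (L0 ++ map snd R) *
    (z0 + 3 + size R * (5 + w * (4 * size (L0 ++ map snd R) + 3)))).

Let step_computes fs (X : graph -> {set 'I_m}) i :
  (forall j, exists2 g, List.In g fs & g =1 (fun a => j \in X a)) ->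
  computes (z0 + 3 + size R * (5 + w * (4 * m + 3))) fs (fun a => i \in step a (X a)).
Proof.
move=> HX.
apply: (@computes_ext _ _ (fun a => init a (node i) || has (fires (X a) i) R)).
  by move=> a; rewrite inE.
apply: (@computes_le (z0.+1 + (size R * (4 + w * (4 * m + 3)).+1).+1).+1); first by lia.
apply: computes_or.
  by move=> gs g1 _; apply: init_computes.
apply: computes_has => -[Y phi] YR; rewrite /fires /=.
apply: (@computes_le (1 + (size Y * (m * 4).+2).+1).+1).
  by have := allP R_w _ YR => /= Yw; nia.
apply: computes_and; first exact: computes_const.
apply: computes_all => psi _.
have -> : m * 4 = size (enum 'I_m) * 4 by rewrite -cardE card_ord.
apply: (computes_has (z := 3)) => j _; apply: (@computes_le (1 + 0).+1) => //.
by apply: computes_and; [exact: computes_const|exact: computes_mem].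
Qed.

Let step_mono a : {homo step a : X Y / X \subset Y}.
Proof.
move=> X Y /subsetP XY; apply/subsetP => i; rewrite !inE => /orP [->//|/hasP [r rR H]].
apply/orP; right; apply/hasP; exists r => //; case/andP: H => rn /allP H.
rewrite /fires rn; apply/allP => psi /H /hasP [j jm /andP [jp jX]].
by apply/hasP; exists j; rewrite // jp XY.
Qed.

Let stage_computes t : exists gs, [/\ program gs,
  size gs <= t.+1 * (m * (z0 + 3 + size R * (5 + w * (4 * m + 3)))) &
  forall j, exists2 g, List.In g gs & g =1 (fun a => j \in iter t (step a) set0)].
Proof.
elim: t => [|t [gs [g1 g2 g3]]].
  have [|||hs [h1 h2 h3 h4]] := @computes_list 'I_m 1 [::] (fun _ _ => false) (enum 'I_m) [::].
  - by move=> *; exact: computes_const.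
  - exact: program_nil.
  - by [].
  exists hs; split=> // [|j].
    by apply: (leq_trans h3); rewrite -cardE card_ord /=; nia.
  have [|g gh ge] := h4 j; first by rewrite mem_enum.
  by exists g => // a; rewrite ge inE.
have [||hs [h1 h2 h3 h4]] := @computes_list 'I_m
    (z0 + 3 + size R * (5 + w * (4 * m + 3))) gs
    (fun i a => i \in step a (iter t (step a) set0)) (enum 'I_m) gs _ g1.
- by move=> i _; exact: step_computes.
- by [].
exists hs; split=> // [|j].
  by apply: (leq_trans h3); rewrite -cardE card_ord /=; nia.
by have [|g gh ge] := h4 j; [rewrite mem_enum|exists g].
Qed.

(** The closure stays inside [nodes], so iterating the monotone [step] from the empty set is
    stationary after [m] rounds, and the circuit unrolls them. Doubling [horn_cost] absorbs the
    factor [m.+1] of [stage_computes]. *)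
Lemma horn_computable phi : exists fs f,
  [/\ program fs, List.In f fs, size fs <= horn_cost.*2 & forall a, f a <-> horn R (init a) phi].
Proof.
have fixE a : step a (iter m (step a) set0) = iter m (step a) set0.
  by have := fixsetK (@step_mono a); rewrite /fixset card_ord.
have sound a t j : j \in iter t (step a) set0 -> horn R (init a) (node j).
  elim: t j => [|t IH] j /=; first by rewrite inE.
  rewrite inE => /orP [|/hasP [[X psi] XR /andP [/= /eqP <- /allP H]]].
    by move=> H; apply: horn_init.
  apply: (@horn_step _ _ _ X); first exact/In_mem.
  by move=> chi /In_mem /H /hasP [i _ /andP [/eqP <- /IH]].
have complete a psi : horn R (init a) psi ->
    psi \in nodes /\ forall j, node j = psi -> j \in iter m (step a) set0.
  elim=> {psi} [psi ipsi|X psi /In_mem XR _ IH].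
    split=> [|j jpsi]; first by rewrite mem_cat (init_L0 ipsi).
    by rewrite -fixE inE jpsi ipsi.
  split=> [|j jpsi].
    by rewrite mem_cat; apply/orP; right; apply/mapP; exists (X, psi).
  rewrite -fixE inE; apply/orP; right; apply/hasP; exists (X, psi) => //.
  rewrite /fires /= jpsi eqxx; apply/allP => chi /In_mem /IH [/node_surj [i ie] iX].
  by apply/hasP; exists i; rewrite ?mem_enum // ie eqxx iX.
case: (boolP (phi \in nodes)) => [/node_surj [j jphi]|nphi].
  have [gs [g1 g2 g3]] := stage_computes m; have [g gi ge] := g3 j.
  exists gs, g; split=> // [|a].
    apply: (leq_trans g2); rewrite /horn_cost -/nodes -/m.
    have : 0 < m by apply: leq_trans (ltn_ord j).
    nia.
  by rewrite ge; split=> [/sound|/complete [_]]; [rewrite jphi|exact].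
exists [:: fun=> false], (fun=> false); split=> //; first exact/program_const/program_nil.
- by left.
- move=> a; split=> // /complete [jphi]; case/negP: nphi; exact: jphi.
Qed.

End Horn.

(** * Forks and diamonds in the Lindenbaum algebra *)

Notation bor := (bigop Or Bot).
Notation band := (bigop And Top).

(** * Natural deduction for [M] *)

Section SuperIntuitionistic.
Variable M : (lform -> Prop) -> lform -> Prop.
Hypothesis HM : super_intuitionistic M.

Definition ent (G : list lform) (phi : lform) : Prop := M (lset G) phi.

Lemma ent_hyp G phi : In phi G -> ent G phi.
Proof. by case: HM => cr _; exact: (cr_refl cr). Qed.

Lemma ent_trans G H phi : ent G phi -> (forall psi, In psi G -> ent H psi) -> ent H phi.
Proof. by case: HM => cr _; exact: (cr_trans cr). Qed.

Lemma ent_weak G H phi : incl G H -> ent G phi -> ent H phi.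
Proof. by move=> GH /ent_trans; apply=> psi /GH; exact: ent_hyp. Qed.

Lemma ent_cut G phi psi : ent G phi -> ent (phi :: G) psi -> ent G psi.
Proof. by move=> H /ent_trans; apply=> chi [<- //|]; exact: ent_hyp. Qed.

Lemma LJ_closed ps G phi : LJ_rule ps (G, [:: phi]) ->
  (forall s, In s ps -> M (lset s.1) (bor s.2)) -> ent G phi.
Proof. by case: HM => _ cl /cl H /H. Qed.

Lemma imp_intro G phi psi : ent (phi :: G) psi -> ent G (Imp phi psi).
Proof. by move=> H; apply: LJ_closed (LJ_Rimp _ _ _) _ => s [<-|[]]. Qed.

Lemma imp_elim phi G psi : ent G (Imp phi psi) -> ent G phi -> ent G psi.
Proof.
move=> H1 H2; apply: (@ent_trans [:: Imp phi psi; phi]); last by move=> chi [<-|[<-|[]]].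
apply: LJ_closed (LJ_Limp [:: phi] [::] phi psi (Some psi)) _ => s [<-|[<-|[]]];
  by apply: ent_hyp; left.
Qed.

Lemma and_intro G phi psi : ent G phi -> ent G psi -> ent G (And phi psi).
Proof. by move=> H1 H2; apply: LJ_closed (LJ_Rand _ _ _) _ => s [<-|[<-|[]]]. Qed.

Lemma and_elim1 G phi psi : ent G (And phi psi) -> ent G phi.
Proof.
move=> H; apply: (@ent_trans [:: And phi psi]); last by move=> chi [<-|[]].
apply: LJ_closed (LJ_Land1 [::] phi psi (Some phi)) _ => s [<-|[]].
by apply: ent_hyp; left.
Qed.

Lemma and_elim2 G phi psi : ent G (And phi psi) -> ent G psi.
Proof.
move=> H; apply: (@ent_trans [:: And phi psi]); last by move=> chi [<-|[]].
apply: LJ_closed (LJ_Land2 [::] phi psi (Some psi)) _ => s [<-|[]].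
by apply: ent_hyp; left.
Qed.

Lemma or_intro1 G phi psi : ent G phi -> ent G (Or phi psi).
Proof. by move=> H; apply: LJ_closed (LJ_Ror1 _ _ _) _ => s [<-|[]]. Qed.

Lemma or_intro2 G phi psi : ent G psi -> ent G (Or phi psi).
Proof. by move=> H; apply: LJ_closed (LJ_Ror2 _ _ _) _ => s [<-|[]]. Qed.

Lemma or_elim phi psi G chi : ent G (Or phi psi) ->
  ent (phi :: G) chi -> ent (psi :: G) chi -> ent G chi.
Proof.
move=> H H1 H2; apply: ent_cut H _.
by apply: LJ_closed (LJ_Lor _ _ _ (Some chi)) _ => s [<-|[<-|[]]].
Qed.

Lemma bot_elim G phi : ent G Bot -> ent G phi.
Proof. by move=> H; apply: LJ_closed (LJ_Rw _ _) _ => s [<-|[]]. Qed.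

Lemma top_intro G : ent G Top.
Proof. by apply: (@ent_weak [::]) => [?|] //; apply: LJ_closed LJ_top _. Qed.

Lemma bor_intro phi G s : In phi s -> ent G phi -> ent G (bor s).
Proof.
elim: s => // x [|y s] IH; first by case=> // ->.
case=> [->|/IH H] Gp; first exact: or_intro1.
by apply: or_intro2; exact: H.
Qed.

Lemma bor_elim s G chi : ent G (bor s) -> (forall phi, In phi s -> ent (phi :: G) chi) -> ent G chi.
Proof.
elim: s G => [|x [|y s] IH] G H Hs; first exact: bot_elim.
  by apply: ent_cut H _; apply: Hs; left.
apply: or_elim H _ _; first by apply: Hs; left.
apply: IH => [|phi phis]; first by apply: ent_hyp; left.
apply: ent_weak (Hs phi _); last by right.
by move=> z [<-|zG]; [left|do 2 right].
Qed.

Lemma band_elim phi s G : In phi s -> ent G (band s) -> ent G phi.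
Proof.
elim: s => // x [|y s] IH; first by case=> // ->.
by case=> [->|/IH H]; [exact: and_elim1|move=> /and_elim2].
Qed.

End SuperIntuitionistic.

Ltac hyp := match goal with HM : super_intuitionistic _ |- _ =>
  solve [apply: (ent_hyp HM); simpl; tauto] end.

(** * From refuted branching axioms to fork algebras *)

Section Branching.
Variable M : (lform -> Prop) -> lform -> Prop.
Hypothesis HM : super_intuitionistic M.

Lemma lsubst_bigop op e s sigma :
  (forall a b, lsubst sigma (op a b) = op (lsubst sigma a) (lsubst sigma b)) ->
  lsubst sigma e = e ->
  lsubst sigma (bigop op e s) = bigop op e (List.map (lsubst sigma) s).
Proof. by move=> Hop He; elim: s => // x [|y s] IH //; rewrite [LHS]Hop IH. Qed.

(** If [M] proved every instance of the axiom, it could replay each derivation in [T_k]. The context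
    [G] consists of the conjuncts in the antecedent of an unprovable instance. *)
Lemma refuted_branching k : ~ branching k M -> exists (V : nat -> lform) G,
  let idx := List.seq 0 (k + 1) in
  ~ ent M G (bor (List.map V idx)) /\
  forall i, In i idx ->
    ent M G (Imp (Imp (V i) (bor (List.map V (List.filter (fun j => negb (Nat.eqb j i)) idx))))
                 (bor (List.map V idx))).
Proof.
move=> nb; have [sigma nax] : exists sigma, ~ ent M [::] (lsubst sigma (Tk_axiom k)).
  apply: NNPP => ne; case: nb => phi Hphi.
  suff : holds M ([::], [:: phi]) by [].
  elim: Hphi => [psi [sigma ->]|ps c r _ IH]; last by case: HM => _ /(_ _ _ r IH).
  by apply: NNPP => nM; case: ne; exists sigma.
pose V i := sigma (vx i).
pose idx := List.seq 0 (k + 1).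
pose A i := Imp (Imp (V i) (bor (List.map V (List.filter (fun j => negb (Nat.eqb j i)) idx))))
                 (bor (List.map V idx)).
exists V, (List.map A idx) => /=; split=> [H|i ii]; last first.
  by apply: ent_hyp => //; exact: in_map.
case: nax; rewrite /Tk_axiom /=; apply: imp_intro => //.
rewrite !lsubst_bigop // !map_map /=.
set s := List.map _ _; have -> : s = List.map A idx.
  by apply: map_ext => i; rewrite /A !lsubst_bigop // !map_map.
apply: ent_trans HM _ _ _ H _ => psi psiin; apply: (band_elim HM) psiin _.
by apply: ent_hyp => //; left.
Qed.

(** Greedy choice: a formula is added unless it would yield [P], and one left out still yields [P]
    over the larger context. *)
Lemma saturate (Es G : list lform) P : ~ ent M G P -> exists G',
  [/\ incl G G', ~ ent M G' P & forall E, In E Es -> In E G' \/ ent M (E :: G') P].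
Proof.
elim: Es G => [|E Es IH] G nP; first by exists G; split.
have [EP|nEP] := classic (ent M (E :: G) P); last first.
  have [G' [i1 n1 H]] := IH _ nEP; exists G'; split=> // [x xG|E' [<-|/H //]].
    by apply: i1; right.
  by left; apply: i1; left.
have [G' [i1 n1 H]] := IH _ nP; exists G'; split=> // E' [<-|/H //].
right; apply: (ent_weak HM) EP => x [<-|/i1 h]; [by left|by right].
Qed.

Lemma split_list (s : list nat) (Q Q' : nat -> Prop) : NoDup s ->
  (forall i, In i s -> Q i \/ Q' i) -> exists B C,
  [/\ NoDup B /\ NoDup C, List.length B + List.length C = List.length s,
      forall i, In i s <-> In i B \/ In i C,
      forall i, In i B -> ~ In i C & (forall i, In i B -> Q i) /\ forall i, In i C -> Q' i].
Proof.
elim: s => [|x s IH] nd H.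
  by exists [::], [::]; split=> //; intuition constructor.
have [xs nds] : ~ In x s /\ NoDup s by split; inversion nd.
have [|B [C [[ndB ndC] l io dj [HB HC]]]] := IH nds.
  by move=> i si; apply: H; right.
have nB : ~ In x B by move=> xB; apply: xs; apply/io; left.
have nC : ~ In x C by move=> xC; apply: xs; apply/io; right.
have [Qx|Qx] := H x (or_introl erefl).
  exists (x :: B), C; split; first by split=> //; constructor.
  - by rewrite /= -l.
  - by move=> i /=; rewrite io; tauto.
  - by move=> i [<- //|/dj].
  - by split=> // i [<- //|/HB].
exists B, (x :: C); split; first by split=> //; constructor.
- by rewrite /= -l addnS.
- by move=> i /=; rewrite io; tauto.
- by move=> i iB [xi|]; [subst i|exact: dj].
- by split=> // i [<- //|/HC].
Qed.

(* Up to [M]-equivalence over [G], [T], the [W i] and their joins form, together with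
   [Top], a copy of the Heyting algebra of upsets of the fork with [m] leaves
   (when [T] is [Bot]) or of the [m]-diamond (when [T] is dense; it then
   represents the top point). *)
Record fork_algebra (dm : bool) (m : nat) (G : list lform) (W : nat -> lform) (T : lform) : Prop := {
  fa_le : forall i, i < m -> ent M (T :: G) (W i);
  fa_meet : forall i j, i < m -> j < m -> i <> j -> ent M (W i :: W j :: G) T;
  fa_join : forall i, i < m -> ent M (Imp (W i) T :: G) (bor (List.map W (List.seq 0 m)));
  fa_proper : ~ ent M G (bor (List.map W (List.seq 0 m)));
  fa_top : if dm then ent M (Imp T Bot :: G) Bot else T = Bot
}.

Lemma bor_map_intro (A : Type) (V : A -> lform) s i G : In i s -> ent M G (V i) ->
  ent M G (bor (List.map V s)).
Proof. by move=> si; apply: (bor_intro HM); exact: in_map. Qed.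

Lemma bor_map_elim (A : Type) (V : A -> lform) s G chi : ent M G (bor (List.map V s)) ->
  (forall i, In i s -> ent M (V i :: G) chi) -> ent M G chi.
Proof. by move=> H Hs; apply: (bor_elim HM) H _ => phi /in_map_iff [i [<- /Hs]]. Qed.

Section Construction.
Variables (idx : list nat) (V : nat -> lform) (G : list lform).
Let P := bor (List.map V idx).
Let others i := List.filter (fun j => negb (Nat.eqb j i)) idx.
Hypotheses (nP : ~ ent M G P)
  (HG : forall i, In i idx -> ent M G (Imp (Imp (V i) (bor (List.map V (others i)))) P)).

Let O := bor (List.map (fun ij => And (V ij.1) (V ij.2))
  (List.filter (fun ij => negb (Nat.eqb ij.1 ij.2)) (list_prod idx idx))).
Let NO := Imp O Bot.
Let E i := Imp (V i) (Or O NO).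

Let O_intro i j H : In i idx -> In j idx -> i <> j -> ent M H (V i) -> ent M H (V j) -> ent M H O.
Proof.
move=> ii jj ij hi hj; apply: (@bor_map_intro _ _ _ (i, j)); last exact: and_intro.
by apply/filter_In; split; [exact: in_prod|apply/negP => /Nat.eqb_eq].
Qed.

Let O_elim H chi : ent M H O ->
  (forall i j, In i idx -> In j idx -> i <> j -> ent M (V i :: V j :: H) chi) -> ent M H chi.
Proof.
move=> HO Hij; apply: bor_map_elim HO _ => -[i j] /filter_In [/in_prod_iff [ii jj] /negP ij].
have /Hij {}Hij : i <> j by move=> /Nat.eqb_eq.
apply: (@ent_trans _ HM) (Hij ii jj) _ => psi [<-|[<-|psiH]].
- by apply: (@and_elim1 _ HM _ _ (V j)); hyp.
- by apply: (@and_elim2 _ HM _ (V i)); hyp.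
- by apply: (ent_hyp HM); right.
Qed.

Let P_elim H chi : ent M H P -> (forall i, In i idx -> ent M (V i :: H) chi) -> ent M H chi.
Proof. exact: bor_map_elim. Qed.

Let P_intro i H : In i idx -> ent M H (V i) -> ent M H P.
Proof. exact: bor_map_intro. Qed.

Let O_P H : ent M H O -> ent M H P.
Proof. by move=> /O_elim; apply=> i j ii _ _; apply: P_intro ii _; hyp. Qed.

Let G_P i H : incl G H -> In i idx -> ent M (V i :: H) (bor (List.map V (others i))) -> ent M H P.
Proof.
move=> GH /HG Hi Hd; apply: (imp_elim HM) (ent_weak HM GH Hi) _.
exact: imp_intro.
Qed.

Lemma nth_inj s i j : NoDup s -> i < List.length s -> j < List.length s -> i <> j ->
  List.nth i s 0 <> List.nth j s 0.
Proof. by move=> /NoDup_nth nd i1 j1 ij H; apply: ij; apply: nd H; apply/ltP. Qed.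

Lemma nth_surj s (i : nat) : In i s -> exists2 t, t < List.length s & List.nth t s 0 = i.
Proof. by move=> /(@In_nth _ _ _ 0) [t [/ltP tl ti]]; exists t. Qed.

(** As [O] entails [P], the formula [T] amounts to [P] together with [O \/ ~O], so each [V j] with
    [j] in [C] entails [T]. If [W t] implies [T], then its [V i] implies [O \/ ~O]; this is [E i],
    which yields [P] because [i] is in [B]. Density: the negation of [T] gives [~O], then refutes
    every [V i], and the branching hypothesis yields [P], hence [T]. *)
Lemma diamond_algebra B C : NoDup B -> 0 < List.length B ->
  (forall i, In i idx <-> In i B \/ In i C) ->
  (forall i, In i B -> ent M (E i :: G) P) -> (forall i, In i C -> In (E i) G) ->
  exists W T, fork_algebra true (List.length B) G W T.
Proof.
move=> ndB B0 io HB HC.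
pose T := Or O (And P NO); pose W t := Or (V (List.nth t B 0)) T.
exists W, T.
have inB t : t < List.length B -> In (List.nth t B 0) B by move=> /ltP; exact: nth_In.
have Binc i : In i B -> In i idx by rewrite io; left.
have W_P t H : t < List.length B -> ent M H (W t) -> ent M H P.
  move=> tB /(or_elim HM); apply; first by apply: (@P_intro (List.nth t B 0)); [apply/Binc/inB|hyp].
  apply: (@or_elim _ HM O (And P NO)); [by hyp|by apply: O_P; hyp|].
  by apply: (@and_elim1 _ HM _ _ NO); hyp.
split.
- by move=> t _; apply: or_intro2 => //; hyp.
- move=> i j iB jB ij; apply: (@or_elim _ HM (V (List.nth i B 0)) T); [by hyp| |by hyp].
  apply: (@or_elim _ HM (V (List.nth j B 0)) T); [by hyp| |by hyp].
  apply: or_intro1 => //; apply: (@O_intro (List.nth i B 0) (List.nth j B 0)); try by hyp.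
  + exact/Binc/inB.
  + exact/Binc/inB.
  + exact: nth_inj.
- move=> t tB; set H := Imp (W t) T :: G.
  have GH : incl G H by move=> x; right.
  have HP : ent M H P.
    apply: (@ent_cut _ HM _ (E (List.nth t B 0))); last first.
      by apply: (ent_weak HM) (HB _ (inB _ tB)) => x [<-|xG]; [left|do 2 right].
    apply: imp_intro => //; apply: (@or_elim _ HM O (And P NO)).
    + apply: (@imp_elim _ HM (W t)); [by hyp|apply: or_intro1 => //; hyp].
    + by apply: or_intro1 => //; hyp.
    + by apply: or_intro2 => //; apply: (@and_elim2 _ HM _ P); hyp.
  apply: P_elim (HP) _ => j /io [jB|jC].
    have [s sB sj] := nth_surj jB; apply: (@bor_map_intro _ _ _ s).
      by apply/in_seq; lia.
    by apply: or_intro1 => //; rewrite sj; hyp.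
  apply: (@bor_map_intro _ _ _ t); first by apply/in_seq; lia.
  apply: or_intro2 => //; apply: (@or_elim _ HM O NO).
  + apply: (@imp_elim _ HM (V j)); last by hyp.
    by apply: (ent_hyp HM); right; apply: GH; exact: HC.
  + by apply: or_intro1 => //; hyp.
  + apply: or_intro2 => //; apply: and_intro => //; last by hyp.
    by apply: (ent_weak HM) HP => x; do 2 right.
- move=> H; apply: nP; apply: bor_map_elim H _ => t /in_seq tB.
  by apply: (W_P t); [lia|hyp].
- set H := Imp T Bot :: G.
  have HNO : ent M H NO.
    apply: imp_intro => //; apply: (@imp_elim _ HM T); first by hyp.
    by apply: or_intro1 => //; hyp.
  have HP : ent M H P.
    have b0 := Binc _ (inB _ B0).
    apply: (@G_P (List.nth 0 B 0)) => //; first by move=> x; right.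
    apply: bot_elim => //; apply: (@imp_elim _ HM T); first by hyp.
    apply: or_intro2 => //; apply: and_intro => //.
      by apply: P_intro b0 _; hyp.
    by apply: (ent_weak HM) HNO => x; right.
  apply: (@imp_elim _ HM T); first by hyp.
  by apply: or_intro2 => //; exact: and_intro.
Qed.

(** The leaf [W 0] absorbs [O] and all [V j] with [j] in [B]. Any other [W t] contains [~O], so it
    excludes [O], and also each such [V j], which together with [V (c t)] would give [O]. If [W t]
    is refuted, [V (c t)] implies [O], hence some [V j] with another index, and the branching
    hypothesis yields [P]. *)
Lemma plain_fork_algebra B C : NoDup C -> 0 < List.length C ->
  (forall i, In i idx <-> In i B \/ In i C) -> (forall i, In i B -> ~ In i C) ->
  (forall i, In i C -> In (E i) G) ->
  exists W, fork_algebra false (List.length C) G W Bot.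
Proof.
move=> ndC C0 io dj HC.
pose c t := List.nth t C 0.
pose D := Or O (bor (List.map V B)).
pose W t := if t is 0 then Or (And (V (c 0)) NO) D else And (V (c t)) NO.
exists W.
have inC t : t < List.length C -> In (c t) C by move=> /ltP; exact: nth_In.
have Cinc i : In i C -> In i idx by rewrite io; right.
have W_V t H : ent M H (V (c t)) -> ent M H NO -> ent M H (W t).
  by move=> h1 h2; case: t h1 => [|t] h1; [apply: or_intro1 => //|]; apply: and_intro.
have absurd i j H : In i idx -> In j idx -> i <> j -> ent M H (V i) -> ent M H (V j) ->
    ent M H NO -> ent M H Bot.
  by move=> ii jj ij h1 h2 h3; apply: (imp_elim HM h3); exact: O_intro h1 h2.
have W0_meet t H : 0 < t -> t < List.length C -> ent M H (W 0) -> ent M H (W t) -> ent M H Bot.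
  case: t => // t _ tC h0 ht.
  have hV := and_elim1 HM ht; have hNO := and_elim2 HM ht.
  have ci := Cinc _ (inC _ tC).
  apply: (or_elim HM) h0 _ _.
    apply: (@absurd (c 0) (c t.+1)) => //; first exact/Cinc/inC.
    - exact: nth_inj.
    - by apply: (@and_elim1 _ HM _ _ NO); hyp.
    - by apply: (ent_weak HM) hV => x; right.
    - by apply: (ent_weak HM) hNO => x; right.
  apply: (@or_elim _ HM O (bor (List.map V B))); first by hyp.
    apply: (@imp_elim _ HM O); last by hyp.
    by apply: (ent_weak HM) hNO => x; do 2 right.
  apply: (@bor_map_elim _ V B); first by hyp.
  move=> j jB; apply: (@absurd j (c t.+1)) => //; first by apply/io; left.
  - by move=> jc; apply: (dj j jB); rewrite jc; exact: inC.
  - by hyp.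
  - by apply: (ent_weak HM) hV => x; do 3 right.
  - by apply: (ent_weak HM) hNO => x; do 3 right.
have W_P t H : t < List.length C -> ent M H (W t) -> ent M H P.
  case: t => [|t] tC hW; last first.
    by apply: (@P_intro (c t.+1)); [exact/Cinc/inC|apply: and_elim1 hW].
  apply: (or_elim HM) hW _ _.
    apply: (@P_intro (c 0)); first exact/Cinc/inC.
    by apply: (@and_elim1 _ HM _ _ NO); hyp.
  apply: (@or_elim _ HM O (bor (List.map V B))); first by hyp.
    by apply: O_P; hyp.
  apply: (@bor_map_elim _ V B); first by hyp.
  by move=> j jB; apply: (@P_intro j); [apply/io; left|hyp].
split=> //.
- by move=> t _; apply: bot_elim => //; hyp.
- case=> [|i] [|j] // iC jC ij.
  + by apply: (@W0_meet j.+1) => //; hyp.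
  + by apply: (@W0_meet i.+1) => //; hyp.
  + apply: (@absurd (c i.+1) (c j.+1)).
    * exact/Cinc/inC.
    * exact/Cinc/inC.
    * exact: nth_inj.
    * by apply: (@and_elim1 _ HM _ _ NO); hyp.
    * by apply: (@and_elim1 _ HM _ _ NO); hyp.
    * by apply: (@and_elim2 _ HM _ (V (c i.+1))); hyp.
- move=> t tC; set H := Imp (W t) Bot :: G.
  have GH : incl G H by move=> x; right.
  have EH j : In j C -> ent M (V j :: H) (Or O NO).
    move=> jC; apply: (@imp_elim _ HM (V j)); last by hyp.
    by apply: (ent_hyp HM); right; apply: GH; exact: HC.
  have HP : ent M H P.
    have tC' := inC _ tC.
    apply: (@G_P (c t)) => //; first exact: Cinc.
    apply: (or_elim HM) (EH _ tC') _ _.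
      apply: O_elim; first by hyp.
      move=> i j ii jj ij; have [it|it] := eqVneq i (c t).
        apply: (@bor_map_intro _ _ _ j); last by hyp.
        by apply/filter_In; split=> //; apply/negP => /Nat.eqb_eq jt; apply: ij; rewrite it.
      apply: (@bor_map_intro _ _ _ i); last by hyp.
      by apply/filter_In; split=> //; apply/negP => /Nat.eqb_eq /eqP; rewrite (negbTE it).
    apply: bot_elim => //; apply: (@imp_elim _ HM (W t)); first by hyp.
    by apply: W_V; hyp.
  apply: P_elim HP _ => j /io [jB|jC].
    apply: (@bor_map_intro _ _ _ 0); first by apply/in_seq; lia.
    apply: or_intro2 => //; apply: or_intro2 => //.
    by apply: (bor_map_intro jB); hyp.
  apply: (or_elim HM) (EH _ jC) _ _.
    apply: (@bor_map_intro _ _ _ 0); first by apply/in_seq; lia.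
    by apply: or_intro2 => //; apply: or_intro1 => //; hyp.
  have [s sC sj] := nth_surj jC; apply: (@bor_map_intro _ _ _ s).
    by apply/in_seq; lia.
  by apply: W_V; rewrite /c ?sj; hyp.
- move=> H; apply: nP; apply: bor_map_elim H _ => t /in_seq tC.
  by apply: (W_P t); [lia|hyp].
Qed.

End Construction.

(** Of the [N + N + 1] indices, either at least [N] lie in [B], which gives a diamond, or more than
    [N] lie in [C], which gives a fork. *)
Lemma fork_algebra_exists N : infinite_branching M -> 0 < N ->
  exists dm m G W T, N <= m /\ fork_algebra dm m G W T.
Proof.
move=> inf N0; have [V [G0 /= [n0 H0]]] := refuted_branching (inf (N + N)).
set idx := List.seq 0 _ in n0 H0.
pose O := bor (List.map (fun ij => And (V ij.1) (V ij.2))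
  (List.filter (fun ij => negb (Nat.eqb ij.1 ij.2)) (list_prod idx idx))).
pose E i := Imp (V i) (Or O (Imp O Bot)).
have [G [GG nG HE]] := saturate (List.map E idx) n0.
have H1 i : In i idx -> ent M G (Imp (Imp (V i) (bor (List.map V
    (List.filter (fun j => negb (Nat.eqb j i)) idx)))) (bor (List.map V idx))).
  by move=> /H0; exact: ent_weak.
have [||B [C [[ndB ndC] len io dj [HB HC]]]] := @split_list idx
  (fun i => ent M (E i :: G) (bor (List.map V idx))) (fun i => In (E i) G).
- exact: seq_NoDup.
- by move=> i ii; case: (HE (E i)); [exact: in_map|right|left].
rewrite length_seq in len.
have [NB|BN] := leqP N (List.length B).
  have B0 : 0 < List.length B by lia.
  have [W [T HW]] := @diamond_algebra _ V G nG H1 B C ndB B0 io HB HC.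
  by exists true, (List.length B), G, W, T.
have [|W HW] := @plain_fork_algebra _ V G nG H1 B C ndC _ io dj HC; first by lia.
exists false, (List.length C), G, W, Bot; split=> //; lia.
Qed.

End Branching.

(** * Soundness in forks and diamonds *)

Fixpoint top_eval (tv : var -> bool) (phi : lform) : bool :=
  match phi with
  | Var p => tv p
  | Top => true
  | Bot => false
  | And a b => top_eval tv a && top_eval tv b
  | Or a b => top_eval tv a || top_eval tv b
  | Imp a b => top_eval tv a ==> top_eval tv b
  end.

(* Truth at a point whose only proper successor is, when [dm] holds, the point with
   valuation [tv]; without [dm], there is none. *)
Fixpoint mid_eval (dm : bool) (tv v : var -> bool) (phi : lform) : bool :=
  match phi with
  | Var p => v p
  | Top => true
  | Bot => false
  | And a b => mid_eval dm tv v a && mid_eval dm tv v b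
  | Or a b => mid_eval dm tv v a || mid_eval dm tv v b
  | Imp a b => (mid_eval dm tv v a ==> mid_eval dm tv v b) && (dm ==> (top_eval tv a ==> top_eval tv b))
  end.

(* Truth at the root of a fork ([dm = false]) or diamond ([dm = true]). *)
Fixpoint root_eval (dm : bool) (tv : var -> bool) (m : nat) (lv : nat -> var -> bool)
    (rv : var -> bool) (phi : lform) : bool :=
  match phi with
  | Var p => rv p
  | Top => true
  | Bot => false
  | And a b => root_eval dm tv m lv rv a && root_eval dm tv m lv rv b
  | Or a b => root_eval dm tv m lv rv a || root_eval dm tv m lv rv b
  | Imp a b => (root_eval dm tv m lv rv a ==> root_eval dm tv m lv rv b)
               && all (fun i => mid_eval dm tv (lv i) (Imp a b)) (iota 0 m)
  end.

Lemma mid_eval_top_eval (dm : bool) (tv v : var -> bool) phi : dm -> (forall x, v x -> tv x) -> mid_eval dm tv v phi -> top_eval tv phi.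
Proof.
move=> dmT vt; elim: phi => //= a IHa b IHb.
- by case/andP => /IHa -> /IHb ->.
- by case/orP => [/IHa ->|/IHb ->]; rewrite ?orbT.
- by rewrite dmT => /andP [].
Qed.

Lemma root_eval_mid_eval dm tv m (lv : nat -> var -> bool) (rv : var -> bool) i phi : i < m -> (forall x, rv x -> lv i x) ->
  root_eval dm tv m lv rv phi -> mid_eval dm tv (lv i) phi.
Proof.
move=> im rl; elim: phi => //= a IHa b IHb.
- by case/andP => /IHa /= -> /IHb ->.
- by case/orP => [/IHa /= ->|/IHb /= ->]; rewrite ?orbT.
- by case/andP => _ /allP; apply; rewrite mem_iota.
Qed.

Lemma top_eval_subst tv sigma phi :
  top_eval tv (lsubst sigma phi) = top_eval (fun x => top_eval tv (sigma x)) phi.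
Proof. by elim: phi => //= a -> b ->. Qed.

Lemma mid_eval_subst dm tv v sigma phi : mid_eval dm tv v (lsubst sigma phi) =
  mid_eval dm (fun x => top_eval tv (sigma x)) (fun x => mid_eval dm tv v (sigma x)) phi.
Proof. by elim: phi => //= a -> b -> //; rewrite !top_eval_subst. Qed.

Section Soundness.
Variables (M : (lform -> Prop) -> lform -> Prop) (HM : super_intuitionistic M).
Variables (dm : bool) (m : nat) (G : list lform) (W : nat -> lform) (T : lform).
Hypotheses (fa : fork_algebra M dm m G W T) (m0 : 0 < m).
Implicit Types (r t : bool) (f : nat -> bool).

(* Represents the upset that contains the root iff [r], the leaf [i] iff [f i] and, in
   a diamond, the top point iff [t]. *)
Definition upset_formula (r : bool) (f : nat -> bool) (t : bool) : lform :=
  if r then Top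
  else Or (bor (List.map W (List.filter f (List.seq 0 m)))) (if t then T else Bot).

Lemma upset_elim r f t H psi : ent M H (upset_formula r f t) ->
  (r -> ent M H psi) -> (forall i, i < m -> f i -> ent M (W i :: H) psi) ->
  (dm -> t -> ent M (T :: H) psi) -> ent M H psi.
Proof.
rewrite /upset_formula; case: r => [_ /(_ isT)//|] Hc _ HW HT.
apply: (or_elim HM) Hc _ _.
  apply: (@bor_map_elim _ HM _ W (List.filter f (List.seq 0 m))); first by hyp.
  move=> i /filter_In [/in_seq im fi]; apply: (ent_weak HM) (HW i _ fi); last by lia.
  by move=> x [<-|xH]; [left|do 2 right].
case: t HT => [HT|_]; last by apply: bot_elim => //; hyp.
have := fa_top fa; case: (dm) HT => [/(_ isT isT)//|_ ->].
by apply: bot_elim => //; hyp.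
Qed.

Lemma upset_W i r f t H : i < m -> f i -> ent M H (W i) -> ent M H (upset_formula r f t).
Proof.
rewrite /upset_formula; case: r => [*|im fi HW]; first exact: top_intro.
apply: or_intro1 => //; apply: (@bor_map_intro _ HM _ _ _ i) => //.
by apply/filter_In; split=> //; apply/in_seq; lia.
Qed.

Lemma upset_T r f (t : bool) H : (dm -> t) -> ent M H T -> ent M H (upset_formula r f t).
Proof.
rewrite /upset_formula; case: r => [*|dt HT]; first exact: top_intro.
have := fa_top fa; case: (dm) dt => [/(_ isT) ->|_ TB].
  by move=> _; exact: or_intro2.
by apply: bot_elim => //; rewrite -TB.
Qed.

Lemma upset_root (r : bool) f t H : r -> ent M H (upset_formula r f t).
Proof. by rewrite /upset_formula => ->; exact: top_intro. Qed.

Lemma W_T i H : incl G H -> i < m -> ent M H T -> ent M H (W i).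
Proof.
move=> GH im HT; apply: (ent_cut HM) HT _; apply: (ent_weak HM) (fa_le fa im).
by move=> x [<-|/GH]; [left|right].
Qed.

Lemma W_meet i j H : incl G H -> i < m -> j < m -> i <> j ->
  ent M H (W i) -> ent M H (W j) -> ent M H T.
Proof.
move=> GH im jm ij hi hj; apply: (ent_trans HM) (fa_meet fa im jm ij) _.
by move=> psi [<-|[<-|/GH]] //; exact: ent_hyp.
Qed.

Definition persistent (r : bool) (f : nat -> bool) (t : bool) :=
  (r -> forall i, i < m -> f i) /\ (forall i, i < m -> f i -> dm -> t).

Lemma upset_le (r1 : bool) f1 (t1 r2 : bool) f2 (t2 : bool) H : incl G H ->
  (r1 -> r2) -> (forall i, i < m -> f1 i -> f2 i) -> (dm -> t1 -> t2) ->
  ent M H (upset_formula r1 f1 t1) -> ent M H (upset_formula r2 f2 t2).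
Proof.
move=> GH hr hf ht /upset_elim; apply.
- by move=> /hr; exact: upset_root.
- by move=> i im /hf fi; apply: (@upset_W i) => //; [exact: fi|hyp].
- by move=> hdm t; apply: upset_T => [_|]; [exact: ht|hyp].
Qed.

Lemma upset_and r1 f1 t1 r2 f2 t2 H : incl G H ->
  persistent r1 f1 t1 -> persistent r2 f2 t2 ->
  ent M H (upset_formula r1 f1 t1) -> ent M H (upset_formula r2 f2 t2) ->
  ent M H (upset_formula (r1 && r2) (fun i => f1 i && f2 i) (t1 && t2)).
Proof.
move=> GH [p1 q1] [p2 q2] h1 h2.
have GH' x : incl G (x :: H) by move=> y /GH; right.
have GH'' x y : incl G (x :: y :: H) by move=> z /GH; do 2 right.
have h2' x : ent M (x :: H) (upset_formula r2 f2 t2) by apply: (ent_weak HM) h2 => y; right.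
apply: (upset_elim h1).
- move=> r1T; apply: upset_le h2 => //; first by rewrite r1T.
    by move=> i im ->; rewrite p1.
  by move=> hdm ->; rewrite (q1 0) ?p1.
- move=> i im f1i; apply: (upset_elim (h2' _)).
  + by move=> r2T; apply: (@upset_W i) => //; [rewrite f1i p2|hyp].
  + move=> j jm f2j; have [ij|/eqP ij] := eqVneq i j.
      by apply: (@upset_W i) => //; [rewrite f1i ij|hyp].
    apply: upset_T => [hdm|]; first by rewrite (q1 i) // (q2 j).
    by apply: (@W_meet i j) => //; hyp.
  + by move=> hdm t2T; apply: upset_T => [_|]; [rewrite (q1 i)|hyp].
- move=> hdm t1T; apply: (upset_elim (h2' _)).
  + by move=> r2T; apply: upset_T => [_|]; [rewrite t1T (q2 0) ?p2|hyp].
  + by move=> j jm f2j; apply: upset_T => [_|]; [rewrite t1T (q2 j)|hyp].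
  + by move=> _ t2T; apply: upset_T => [_|]; [rewrite t1T|hyp].
Qed.

Lemma upset_or r1 f1 t1 r2 f2 t2 H : incl G H ->
  ent M H (upset_formula (r1 || r2) (fun i => f1 i || f2 i) (t1 || t2)) ->
  ent M H (Or (upset_formula r1 f1 t1) (upset_formula r2 f2 t2)).
Proof.
move=> GH /upset_elim; apply.
- by case/orP => h; [apply: or_intro1|apply: or_intro2] => //; exact: upset_root.
- move=> i im /orP [] fi; [apply: or_intro1|apply: or_intro2] => //;
    by apply: (@upset_W i) => //; hyp.
- move=> hdm /orP [] tT; [apply: or_intro1|apply: or_intro2] => //;
    by apply: upset_T => //; hyp.
Qed.

Definition fimp (f1 f2 : nat -> bool) (t1 t2 : bool) i :=
  (f1 i ==> f2 i) && (dm ==> (t1 ==> t2)).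

Lemma upset_imp_intro (r1 : bool) f1 (t1 r2 : bool) f2 (t2 : bool) H : incl G H ->
  persistent r1 f1 t1 -> persistent r2 f2 t2 ->
  ent M H (upset_formula ((r1 ==> r2) && all (fimp f1 f2 t1 t2) (iota 0 m)) (fimp f1 f2 t1 t2) (t1 ==> t2)) ->
  ent M H (Imp (upset_formula r1 f1 t1) (upset_formula r2 f2 t2)).
Proof.
move=> GH [p1 q1] [p2 q2] h; apply: imp_intro => //; set H' := _ :: H.
have GH' : incl G H' by move=> y /GH; right.
have h1 : ent M H' (upset_formula r1 f1 t1) by hyp.
have inc x : incl H' (x :: H') by move=> y; right.
have GHi x : incl G (x :: H') by move=> y /GH'; right.
have h1' x : ent M (x :: H') (upset_formula r1 f1 t1) by apply: (ent_weak HM) h1; exact: inc.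
have h' : ent M H' (upset_formula ((r1 ==> r2) && all (fimp f1 f2 t1 t2) (iota 0 m)) (fimp f1 f2 t1 t2) (t1 ==> t2)).
  by apply: (ent_weak HM) h => x; right.
apply: (upset_elim h').
- case/andP => /implyP r12 /allP all_f.
  have fi i : i < m -> fimp f1 f2 t1 t2 i by move=> im; apply: all_f; rewrite mem_iota.
  apply: upset_le h1 => //.
  + by move=> i /fi /andP [/implyP].
  + by move=> hdm; have /andP [_] := fi 0 m0; rewrite hdm /= => /implyP.
- move=> i im /andP [/implyP f12 /implyP t12]; apply: (upset_elim (h1' _)).
  + by move=> r1T; apply: (@upset_W i) => //; [apply: f12; exact: p1|hyp].
  + move=> j jm f1j; have [ij|/eqP ij] := eqVneq i j.
      by apply: (@upset_W i) => //; [apply: f12; rewrite ij|hyp].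
    apply: upset_T => [hdm|]; first by apply: (implyP (t12 hdm)); exact: (q1 j).
    apply: (@W_meet i j) => //; try by hyp.
    by move=> y /GH'; do 2 right.
  + by move=> hdm t1T; apply: upset_T => [_|]; [exact: (implyP (t12 hdm))|hyp].
- move=> hdm /implyP t12; have [t1T|t1F] := boolP t1.
    by apply: upset_T => [_|]; [exact: t12|hyp].
  apply: (upset_elim (h1' _)).
  + by move=> /p1 /(_ 0 m0) /(q1 0 m0) /(_ hdm); rewrite (negbTE t1F).
  + by move=> i im /(q1 i im) /(_ hdm); rewrite (negbTE t1F).
  + by rewrite (negbTE t1F).
Qed.

(** An implication failing at the top point would refute [T], against density. If it fails at the
    leaf [i], then [W i] entails [T], so [fa_join] gives the join of all leaves and the claim is
    checked leaf by leaf; leaves at which it fails again reduce to [T]. *)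
Lemma upset_imp_elim (r1 : bool) f1 (t1 r2 : bool) f2 (t2 : bool) H : incl G H ->
  persistent r1 f1 t1 -> persistent r2 f2 t2 ->
  ent M H (Imp (upset_formula r1 f1 t1) (upset_formula r2 f2 t2)) ->
  ent M H (upset_formula ((r1 ==> r2) && all (fimp f1 f2 t1 t2) (iota 0 m)) (fimp f1 f2 t1 t2) (t1 ==> t2)).
Proof.
move=> GH [p1 q1] [p2 q2] h.
have [allf|/allPn [i]] := boolP (all (fimp f1 f2 t1 t2) (iota 0 m)).
  have [r1T|r1F] := boolP r1; last exact: upset_root.
  have h2 : ent M H (upset_formula r2 f2 t2) by apply: (imp_elim HM h); exact: upset_root.
  apply: upset_le h2 => //.
  - by move=> ->.
  - by move=> i im f2i; apply: (allP allf); rewrite mem_iota.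
  - by move=> _ ->; rewrite implybT.
rewrite mem_iota add0n /= => im; rewrite {1}/fimp negb_and.
have [dt|] := boolP (dm ==> (t1 ==> t2)); last first.
  rewrite !negb_imply => /and3P [hdm t1T t2F] _.
  apply: bot_elim => //.
  have nT : ent M H (Imp T Bot).
    apply: imp_intro => //; apply: (@upset_elim r2 f2 t2).
    - apply: (@imp_elim _ HM (upset_formula r1 f1 t1)).
        by apply: (ent_weak HM) h => x; right.
      by apply: upset_T => //; hyp.
    - by move=> /p2 /(_ 0 m0) /(q2 0 m0) /(_ hdm); rewrite (negbTE t2F).
    - by move=> j jm /(q2 j jm) /(_ hdm); rewrite (negbTE t2F).
    - by rewrite (negbTE t2F).
  apply: (ent_cut HM) nT _; have := fa_top fa; rewrite hdm => HT.
  by apply: (ent_weak HM) HT => x [<-|/GH]; [left|right].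
rewrite orbF negb_imply => /andP [f1i f2i].
have notW j K : incl G K -> ent M K (Imp (upset_formula r1 f1 t1) (upset_formula r2 f2 t2)) -> j < m ->
    f1 j -> ~~ f2 j -> ent M K (W j) -> ent M K T.
  move=> GK hK jm f1j f2j hj.
  have h2 : ent M K (upset_formula r2 f2 t2).
    by apply: (imp_elim HM hK); exact: (@upset_W j).
  apply: (upset_elim h2).
  - by move=> /p2 /(_ _ jm); rewrite (negbTE f2j).
  - move=> l lm f2l; apply: (@W_meet j l) => //.
    + by move=> x /GK; right.
    + by move=> jl; move: f2j; rewrite jl f2l.
    + by apply: (ent_weak HM) hj => x; right.
    + by hyp.
  - by move=> *; hyp.
have hW : ent M H (bor (List.map W (List.seq 0 m))).
  apply: (@ent_cut _ HM _ (Imp (W i) T)); last first.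
    by apply: (ent_weak HM) (fa_join fa im) => x [<-|/GH]; [left|right].
  apply: imp_intro => //; apply: (@notW i) => //; last by hyp.
    by move=> x /GH; right.
  by apply: (ent_weak HM) h => x; right.
apply: (bor_map_elim HM) hW _ => j /in_seq [_ /ltP jm].
have [fj|] := boolP (f1 j ==> f2 j).
  by apply: (@upset_W j) => //; [rewrite /fimp fj dt|hyp].
rewrite negb_imply => /andP [f1j f2j].
apply: upset_T => [hdm|]; first by move: dt; rewrite hdm.
apply: (@notW j) => //; last by hyp.
  by move=> x /GH; right.
by apply: (ent_weak HM) h => x; right.
Qed.

Variables (tv : var -> bool) (lv : nat -> var -> bool) (rv : var -> bool).
Hypotheses (rl : forall i, i < m -> forall x, rv x -> lv i x)
  (lt : dm -> forall i, i < m -> forall x, lv i x -> tv x).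

Let tau x := upset_formula (rv x) (fun i => lv i x) (tv x).
Let val phi := upset_formula (root_eval dm tv m lv rv phi) (fun i => mid_eval dm tv (lv i) phi) (top_eval tv phi).

Lemma persistent_val phi :
  persistent (root_eval dm tv m lv rv phi) (fun i => mid_eval dm tv (lv i) phi) (top_eval tv phi).
Proof.
split=> [h i im|i im h hdm]; first by apply: root_eval_mid_eval h => //; exact: rl.
by apply: mid_eval_top_eval h => //; exact: lt.
Qed.

(** Truth lemma for the substitution [tau]: the formulas representing upsets compose as the upsets
    do in the Heyting algebra of the frame. *)
Lemma val_correct phi H : incl G H -> ent M H (lsubst tau phi) <-> ent M H (val phi).
Proof.
have inc x y : incl x y -> forall z : lform, incl x (z :: y) by move=> xy z t /xy; right.
elim: phi H => [p|||a IHa b IHb|a IHa b IHb|a IHa b IHb] H GH //=.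
- split=> [h|/(upset_elim (H := H))]; first exact: bot_elim.
  by apply=> // i im; rewrite /=.
- split=> h.
    apply: upset_and => //; try exact: persistent_val.
      by apply/IHa => //; exact: and_elim1 h.
    by apply/IHb => //; exact: and_elim2 h.
  apply: and_intro => //; [apply/IHa|apply/IHb] => //; apply: upset_le h => //.
  + by case/andP.
  + by move=> i _ /andP [].
  + by move=> _ /andP [].
  + by case/andP.
  + by move=> i _ /andP [].
  + by move=> _ /andP [].
- split=> h.
    apply: (or_elim HM) h _ _.
      apply: (@upset_le _ _ _ _ _ _ _ _ _ _ _ (proj1 (IHa _ _) _)); last by hyp.
      - by exact: inc.
      - by move=> /= ->.
      - by move=> i _ /= ->.
      - by move=> _ /= ->.
      - exact: inc.
    apply: (@upset_le _ _ _ _ _ _ _ _ _ _ _ (proj1 (IHb _ _) _)); last by hyp.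
    - by exact: inc.
    - by move=> /= ->; rewrite orbT.
    - by move=> i _ /= ->; rewrite orbT.
    - by move=> _ /= ->; rewrite orbT.
    - exact: inc.
  apply: (or_elim HM) (upset_or GH h) _ _.
    by apply: or_intro1 => //; apply/IHa; [exact: inc|hyp].
  by apply: or_intro2 => //; apply/IHb; [exact: inc|hyp].
- split=> h.
    apply: upset_imp_elim => //; try exact: persistent_val.
    apply: imp_intro => //; apply/IHb; first exact: inc.
    apply: (@imp_elim _ HM (lsubst tau a)).
      by apply: (ent_weak HM) h => x; right.
    by apply/IHa; [exact: inc|hyp].
  apply: imp_intro => //; apply/IHb; first exact: inc.
  apply: (@imp_elim _ HM (val a)); last by apply/IHa; [exact: inc|hyp].
  apply: upset_imp_intro; [exact: inc|exact: persistent_val|exact: persistent_val|].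
  by apply: (ent_weak HM) h => x; right.
Qed.

(** The premises become equivalent to [Top], so the instance of the conclusion under [tau] follows
    from [G]. Were the conclusion false at the root, that instance would entail the join of the
    [W i], which [fa_proper] forbids. *)
Lemma root_eval_sound prems concl : M (lset prems) concl ->
  (forall psi, In psi prems -> root_eval dm tv m lv rv psi) -> root_eval dm tv m lv rv concl.
Proof.
move=> Mc Hp; apply/negPn/negP => /negbTE nc; apply: (fa_proper fa).
have inc : incl G G by [].
have : ent M G (lsubst tau concl).
  case: (HM) => cr _; apply: (cr_trans cr _ _ _ (cr_subst cr tau _ _ Mc)) => _ [psi [ppsi ->]].
  by apply/val_correct => //; apply: upset_root; exact: Hp.
move/val_correct => /(_ inc); rewrite /val nc => /upset_elim; apply=> // [i im _|_ _].
  by apply: (@bor_map_intro _ HM _ _ _ i); [apply/in_seq; lia|hyp].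
apply: (@bor_map_intro _ HM _ _ _ 0); first by apply/in_seq; lia.
by apply: W_T => //; [move=> x; right|hyp].
Qed.

End Soundness.

(** * The slash *)

Lemma var_eq_dec (x y : var) : {x = y} + {x <> y}.
Proof. by decide equality; exact: Nat.eq_dec. Qed.

Lemma lform_eq_dec (x y : lform) : {x = y} + {x <> y}.
Proof. by decide equality; exact: var_eq_dec. Qed.

HB.instance Definition _ := hasDecEq.Build lform (compareP lform_eq_dec).

Definition asbool (P : Prop) : bool := if excluded_middle_informative P then true else false.

Lemma asboolP (P : Prop) : reflect P (asbool P).
Proof. by rewrite /asbool; case: excluded_middle_informative => H; constructor. Qed.

Fixpoint subformulas (phi : lform) : list lform :=
  phi :: match phi with
         | And a b | Or a b | Imp a b => subformulas a ++ subformulas b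
         | _ => [::]
         end.

Definition sub_closed (s : list lform) : Prop := forall phi, In phi s ->
  match phi with
  | And a b | Or a b | Imp a b => In a s /\ In b s
  | _ => True
  end.

Lemma in_subformulas phi : In phi (subformulas phi).
Proof. by case: phi; left. Qed.

Lemma sub_closed_subformulas phi : sub_closed (subformulas phi).
Proof.
have aux c a b s : sub_closed (subformulas a) -> sub_closed (subformulas b) ->
    s = c :: subformulas a ++ subformulas b ->
    (match c with And a' b' | Or a' b' | Imp a' b' => a' = a /\ b' = b | _ => True end) ->
    sub_closed s.
  move=> ca cb -> Hc psi [<-|].
    have ia : In a (c :: subformulas a ++ subformulas b).
      by right; apply/in_app_iff; left; exact: in_subformulas.
    have ib : In b (c :: subformulas a ++ subformulas b).
      by right; apply/in_app_iff; right; exact: in_subformulas.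
    by case: c Hc ia ib => // a' b' [-> ->].
  move=> /in_app_iff [/ca|/cb]; case: psi => // x y [ix iy]; split; right; apply/in_app_iff; tauto.
elim: phi => [p|||a IHa b IHb|a IHa b IHb|a IHa b IHb] /=; try by move=> psi [<-|[]].
- exact: (aux (And a b) a b).
- exact: (aux (Or a b) a b).
- exact: (aux (Imp a b) a b).
Qed.

Lemma sub_closed_flat_map s : sub_closed (List.flat_map subformulas s).
Proof.
move=> phi /in_flat_map [x [xs /sub_closed_subformulas H]].
by case: phi H => // a b [ia ib]; split; apply/in_flat_map; exists x.
Qed.

Fixpoint sublists (A : Type) (s : list A) : list (list A) :=
  match s with
  | [::] => [:: [::]]
  | x :: s' => sublists s' ++ List.map (cons x) (sublists s')
  end.

Lemma filter_sublists (A : Type) (p : A -> bool) s : In (List.filter p s) (sublists s).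
Proof.
elim: s => [|x s IH]; first by left.
by rewrite /=; apply/in_app_iff; case: (p x); [right; exact: in_map|left].
Qed.

Lemma sublists_incl (A : Type) (s t : list A) : In t (sublists s) ->
  incl t s /\ List.length t <= List.length s.
Proof.
elim: s t => [|x s IH] t /=; first by case=> // <-; split=> // ? [].
case/in_app_iff => [/IH [i l]|/in_map_iff [t' [<- /IH [i l]]]].
  by split; [move=> y /i; right|exact: leqW].
by split=> // y [<-|/i]; [left|right].
Qed.

Definition rule := (list lform * lform)%type.
Definition inst := (rule * (var -> lform))%type.

Definition rule_formulas (r : rule) : list lform := List.flat_map subformulas (r.2 :: r.1).

(* The valuation of the top point of the diamond: it does not depend on the graph, so
   that the closure rules do not either. *)
Definition all_true : var -> bool := fun=> true.

Definition mid_entails (dm : bool) (tv : var -> bool) (X : list lform) (c : lform) : Prop :=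
  forall v : var -> bool, (dm -> forall x, v x -> tv x) -> (forall psi, In psi X -> mid_eval dm tv v psi) ->
  mid_eval dm tv v c.

Definition top_valuation (sigma : var -> lform) : var -> bool :=
  fun x => top_eval all_true (sigma x).

(** Entailment is tested on the formulas of the rule before substitution. The number of closure
    rules per instance is thus bounded in terms of the rule alone, however large the substituted
    formulas are. *)
Definition inst_rules (dm : bool) (i : inst) : seq (seq lform * lform) :=
  List.map (fun Xc => (List.map (lsubst i.2) Xc.1, lsubst i.2 Xc.2))
    (List.filter (fun Xc => asbool (mid_entails dm (top_valuation i.2) Xc.1 Xc.2))
      (list_prod (sublists (rule_formulas i.1)) (rule_formulas i.1))).

(** Membership in [S] is required at every level, so that slashed formulas hold at all leaves
    satisfying [S], as persistence demands. *)
Fixpoint slash (S : lform -> Prop) (phi : lform) : Prop :=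
  S phi /\
  match phi with
  | Var _ | Top => True
  | Bot => False
  | And a b => slash S a /\ slash S b
  | Or a b => slash S a \/ slash S b
  | Imp a b => slash S a -> slash S b
  end.

Lemma slash_in S phi : slash S phi -> S phi.
Proof. by case: phi => [?|||? ?|? ?|? ?] []. Qed.

Section Slash.
Variables (M : (lform -> Prop) -> lform -> Prop) (HM : super_intuitionistic M).
Variables (dm : bool) (m : nat) (G : list lform) (W : nat -> lform) (T : lform).
Hypothesis (fa : fork_algebra M dm m G W T).

Section Instance.
Variables (S : lform -> Prop) (prems : list lform) (concl : lform) (sigma : var -> lform).
Variable g : var -> bool.
Hypotheses (S_true : forall phi, S phi -> mid_eval dm all_true g phi)
  (S_closed : forall X c, In (X, c) (inst_rules dm (prems, concl, sigma)) ->
     (forall psi, In psi X -> S psi) -> S c)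
  (Mc : M (lset prems) concl)
  (mF : List.length (rule_formulas (prems, concl)) < m).

Let F := rule_formulas (prems, concl).
Let tv := top_valuation sigma.
Let known := List.filter (fun psi => asbool (S (lsubst sigma psi))) F.

Let F_closed : sub_closed F.
Proof. exact: sub_closed_flat_map. Qed.

Let knownP psi : In psi known <-> In psi F /\ S (lsubst sigma psi).
Proof. by rewrite /known filter_In; split=> -[? /asboolP ?]. Qed.

Let deduce c : In c F -> mid_entails dm tv known c -> S (lsubst sigma c).
Proof.
move=> cF e; apply: (@S_closed (List.map (lsubst sigma) known)); last first.
  by move=> psi /in_map_iff [x [<- /knownP []]].
apply/in_map_iff; exists (known, c); split=> //; apply/filter_In; split; last exact/asboolP.
by apply/in_prod => //; exact: filter_sublists.
Qed.

Definition good_leaf (v : var -> bool) : Prop :=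
  (dm -> forall x, v x -> tv x) /\ forall psi, In psi known -> mid_eval dm tv v psi.

Let good_g : good_leaf (fun x => mid_eval dm all_true g (sigma x)).
Proof.
split=> [hdm x|psi /knownP [_ /S_true]]; first exact: mid_eval_top_eval.
by rewrite mid_eval_subst.
Qed.


(** Leaf [i] refutes the [i]-th formula of the rule whenever its instance is outside [S]: without
    such a leaf, [deduce] would put the instance into [S]. The remaining leaves only have to be
    good, and [g] shows that a good one exists. *)
Let leaf_exists (i : nat) : exists v, good_leaf v /\
  (i < List.length F -> ~ S (lsubst sigma (List.nth i F Bot)) -> ~~ mid_eval dm tv v (List.nth i F Bot)).
Proof.
have [[iF nS]|n] := classic (i < List.length F /\ ~ S (lsubst sigma (List.nth i F Bot))); last first.
  by eexists; split; [exact: good_g|move=> ? ?; case: n].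
apply: NNPP => ne; apply: nS; apply: deduce; first by apply/nth_In/ltP.
move=> v v1 v2; apply/negPn/negP => nv; apply: ne; exists v; split=> //; by split.
Qed.

Let leaf (i : nat) : var -> bool :=
  proj1_sig (constructive_indefinite_description _ (leaf_exists i)).

Let leafP i : good_leaf (leaf i) /\
  (i < List.length F -> ~ S (lsubst sigma (List.nth i F Bot)) ->
   ~~ mid_eval dm tv (leaf i) (List.nth i F Bot)).
Proof. exact: proj2_sig (constructive_indefinite_description _ (leaf_exists i)). Qed.

Let root x := asbool (In (Var x) F /\ slash S (sigma x)).

(** Implications are the case that needs many leaves: one whose instance is outside [S] is refuted
    at a leaf with index below [length F < m], so it fails at the root. *)
Let rootP phi : In phi F -> root_eval dm tv m leaf root phi <-> slash S (lsubst sigma phi).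
Proof.
have inS c : In c F -> (forall i, mid_eval dm tv (leaf i) c) <-> S (lsubst sigma c).
  move=> cF; split=> [H|Sc i]; last by have [[_ +] _] := leafP i; apply; apply/knownP.
  apply: NNPP => nS; have [i [/ltP iF ic]] := In_nth _ _ Bot cF.
  by have [_ /(_ iF)] := leafP i; rewrite ic => /(_ nS); rewrite H.
have up c d : In c F -> In d F ->
    (forall v, mid_eval dm tv v c -> mid_eval dm tv v d) -> S (lsubst sigma c) -> S (lsubst sigma d).
  by move=> cF dF cd Sc; apply: deduce dF _ => v _ /(_ c) H; apply: cd; apply: H; apply/knownP.
elim: phi => [p|||a IHa b IHb|a IHa b IHb|a IHa b IHb] inF /=.
- by split=> [/asboolP []|H] //; apply/asboolP.
- by split=> // _; split=> //; apply: (deduce inF).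
- by split=> // -[].
- have [ia ib] := F_closed inF; split.
    case/andP => /(IHa ia) sa /(IHb ib) sb; split=> //.
    apply: (deduce inF) => v _ H /=.
    rewrite !H //; apply/knownP; split=> //; exact: slash_in.
  by case=> _ [/(IHa ia) -> /(IHb ib) ->].
- have [ia ib] := F_closed inF; split.
    case/orP => [/(IHa ia) sa|/(IHb ib) sb]; split; try by [left|right].
      by apply: (up a (Or a b) ia inF _ (slash_in sa)) => v /= ->.
    by apply: (up b (Or a b) ib inF _ (slash_in sb)) => v /= ->; rewrite orbT.
  by case=> _ [/(IHa ia) ->|/(IHb ib) ->]; rewrite ?orbT.
- have [ia ib] := F_closed inF; split.
    case/andP => /implyP ab /allP H; split; last by move=> /(IHa ia) /ab /(IHb ib).
    apply: NNPP => nS; have [i [/ltP iF ic]] := In_nth _ _ Bot inF.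
    have [_ /(_ iF)] := leafP i; rewrite ic => /(_ nS) /negP; apply.
    by apply: H; rewrite mem_iota /= add0n; apply: leq_trans iF (ltnW mF).
  case=> Sab sab; apply/andP; split; first by apply/implyP => /(IHa ia) /sab /(IHb ib).
  by apply/allP => i _; exact: (proj2 (inS _ inF) Sab i).
Qed.

Lemma slash_rule :
  (forall psi, In psi prems -> slash S (lsubst sigma psi)) -> slash S (lsubst sigma concl).
Proof.
have inF psi : In psi (concl :: prems) -> In psi F.
  by move=> H; apply/in_flat_map; exists psi; split=> //; exact: in_subformulas.
move=> Hp; apply/rootP; first by apply: inF; left.
apply: (root_eval_sound HM fa) Mc _; first exact: leq_trans mF.
- move=> i _ x /asboolP [xF /slash_in Sx].
  by have [[_ H] _] := leafP i; apply: (H (Var x)); apply/knownP.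
- by move=> hdm i _; have [[/(_ hdm)]] := leafP i.
- by move=> psi pp; apply/rootP; [apply: inF; right|exact: Hp].
Qed.

End Instance.

Definition closure_rules (Is : list inst) : seq (seq lform * lform) :=
  List.flat_map (inst_rules dm) Is.

(** The closure rules preserve truth at a leaf below the fixed top point for any valuation [g] that
    makes the initial formulas true. The values of the variables [s] and [r] remain free, and are
    later chosen so as to refute [alpha] or [beta]. *)
Lemma horn_true (Is : list inst) (P : lform -> Prop) g phi :
  (forall psi, P psi -> mid_eval dm all_true g psi) ->
  horn (closure_rules Is) P phi -> mid_eval dm all_true g phi.
Proof.
move=> Pg; elim=> {phi} [phi /Pg //|X phi].
move=> /in_flat_map [i [_ /in_map_iff [[Y c] [[<- <-] /filter_In [_ /asboolP e]]]]] _ IH.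
rewrite /= mid_eval_subst; apply: e => [hdm x|psi psiY]; first exact: mid_eval_top_eval.
by have := IH (lsubst i.2 psi); rewrite mid_eval_subst; apply; exact: in_map.
Qed.

End Slash.

Definition is_derivation (P : list rule) (pi : list lform) : Prop :=
  forall earlier psi later, pi = (earlier ++ psi :: later)%list ->
    @by_rule Lbasic P earlier psi.

(** One instance is fixed per line, so that the closure rules grow linearly with the number of
    lines, whatever the size of the lines. *)
Lemma derivation_instances P pi : is_derivation P pi -> exists Is : list inst,
  [/\ List.length Is = List.length pi, forall i, In i Is -> In i.1 P &
      forall earlier psi later, pi = (earlier ++ psi :: later)%list ->
        exists i, [/\ In i Is, psi = lsubst i.2 i.1.2 &
          forall c, In c i.1.1 -> In (lsubst i.2 c) earlier]].
Proof.
elim/rev_ind: pi => [|psi0 pi IH] H.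
  by exists [::]; split=> // -[].
have [|Is [l HP HI]] := IH.
  by move=> e psi la E; apply: (H e psi (la ++ [:: psi0])%list); rewrite E -app_assoc.
have [pr [co [si [inP [E pe]]]]] := H pi psi0 [::] erefl.
exists (((pr, co), si) :: Is); split.
- by rewrite /= l length_app /= Nat.add_1_r.
- by move=> i [<- //|/HP].
- move=> e psi la; have [->|[la' [x ->]]] : la = [::] \/ exists la' x, la = (la' ++ [:: x])%list.
    by elim/rev_ind: (la) => [|x la' _]; [left|right; exists la', x].
  + move=> /(@app_inj_tail _ _ _ _ _) [<- <-]; exists ((pr, co), si); split=> //; by left.
  + rewrite app_comm_cons app_assoc => /(@app_inj_tail _ _ _ _ _) [E' _]; have [i [h1 h2 h3]] := HI _ _ _ E'.
    by exists i; split=> //; right.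
Qed.

(** * The monotone interpolant *)

Lemma mid_eval_bor dm tv v s :
  mid_eval dm tv v (bor s) <-> exists phi, In phi s /\ mid_eval dm tv v phi.
Proof.
elim: s => [|x [|y s] IH]; first by split=> // -[? []].
  by split=> [H|[phi [[<-|[]]]]] //; exists x; split=> //; left.
rewrite [bigop _ _ _]/=; split=> [/orP [H|/IH [phi [h1 h2]]]|[phi [[<-|h] H]]].
- by exists x; split=> //; left.
- by exists phi; split=> //; right.
- by rewrite /= H.
- by apply/orP; right; apply/IH; exists phi.
Qed.

Lemma mid_eval_band dm tv v s :
  mid_eval dm tv v (band s) <-> forall phi, In phi s -> mid_eval dm tv v phi.
Proof.
elim: s => [|x [|y s] IH]; first by split.
  by split=> [H phi [<-|[]]|] //; apply; left.
rewrite [bigop _ _ _]/=; split=> [/andP [H /IH Hs] phi [<-|]|H] //; first exact: Hs.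
by apply/andP; split; [apply: H; left|apply/IH => phi h; apply: H; right].
Qed.

Lemma tr_bigop op e op' e' s : (forall a b, tr (op a b) = op' (tr a) (tr b)) -> tr e = e' ->
  tr (bigop op e s) = bigop op' e' (List.map tr s).
Proof. by move=> Hop He; elim: s => // x [|y s] IH //; rewrite [LHS]Hop IH. Qed.

Lemma tr_fus_big s : tr (fus_big s) = band (List.map tr s).
Proof. exact: tr_bigop. Qed.

Lemma tr_sand_big s : tr (sand_big s) = band (List.map tr s).
Proof. exact: tr_bigop. Qed.

Lemma tr_sor_big s : tr (sor_big s) = bor (List.map tr s).
Proof. exact: tr_bigop. Qed.

Lemma in_pairs n m i j : In (i, j) (pairs n m) <-> i < n /\ j < m.
Proof.
rewrite /pairs; split=> [/in_prod_iff [/in_seq h1 /in_seq h2]|[h1 h2]]; first by lia.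
by apply/in_prod_iff; split; apply/in_seq; lia.
Qed.

Lemma mid_eval_sor_map (A : Type) dm tv v (f : A -> sform) s :
  mid_eval dm tv v (tr (sor_big (List.map f s))) <-> exists x, In x s /\ mid_eval dm tv v (tr (f x)).
Proof.
rewrite tr_sor_big mid_eval_bor; split=> [[phi [/in_map_iff [psi [<- /in_map_iff [x [<- xs]]]] H]]|[x [xs H]]].
  by exists x.
by exists (tr (f x)); split=> //; exact/in_map/in_map.
Qed.

Lemma mid_eval_sand_map (A : Type) dm tv v (f : A -> sform) s :
  mid_eval dm tv v (tr (sand_big (List.map f s))) <-> forall x, In x s -> mid_eval dm tv v (tr (f x)).
Proof.
rewrite tr_sand_big mid_eval_band; split=> [H x xs|H phi /in_map_iff [psi [<- /in_map_iff [x [<- xs]]]]].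
  exact/H/in_map/in_map.
exact: H.
Qed.

Lemma mid_eval_fus_map (A : Type) dm tv v (f : A -> sform) s :
  mid_eval dm tv v (tr (fus_big (List.map f s))) <-> forall x, In x s -> mid_eval dm tv v (tr (f x)).
Proof. by rewrite tr_fus_big -tr_sand_big; exact: mid_eval_sand_map. Qed.

Lemma mid_eval_choices dm tv v n m (x y : nat -> nat -> var) :
  (forall i j, i < n -> j < m -> v (x i j) || v (y i j)) ->
  mid_eval dm tv v (tr (fus_big (List.map (fun '(i, j) => choice (x i j) (y i j)) (pairs n m)))).
Proof.
by move=> H; apply/mid_eval_fus_map => -[i j] /in_pairs [im jm]; rewrite /= !andbT; exact: H.
Qed.

Lemma mid_eval_alpha dm tv v n k : mid_eval dm tv v (tr (alpha n k)) ->
  (exists2 i, i < n & forall l, l < k -> v (vs' i l)) \/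
  exists i j l, [/\ i < n, j < n, l < k & [&& v (vs i l), v (vs j l) & v (vp i j)]].
Proof.
move=> /orP [/mid_eval_sor_map [i [/in_seq iN /mid_eval_sand_map H]]|].
  left; exists i; first by lia.
  by move=> l lk; apply: (H l); apply/in_seq; lia.
move=> /mid_eval_sor_map [[i j] [/in_pairs [iN jN] /mid_eval_sor_map [l [/in_seq lk /= H]]]].
by right; exists i, j, l; split=> //; [lia|rewrite andbA].
Qed.

Lemma mid_eval_beta dm tv v n k : mid_eval dm tv v (tr (beta n k)) ->
  (exists2 l, l < k & forall i, i < n -> v (vr' i l)) \/
  exists i j l m, [/\ i < n, j < n, l < m, m < k & [&& v (vr i l), v (vr j m) & v (vq i j)]].
Proof.
move=> /orP [/mid_eval_sor_map [l [/in_seq lk /mid_eval_sand_map H]]|].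
  left; exists l; first by lia.
  by move=> i iN; apply: (H i); apply/in_seq; lia.
move=> /mid_eval_sor_map [[i j] [/in_pairs [iN jN] /mid_eval_sor_map [[l m] [/filter_In [/in_pairs [lk mk] lm] /= H]]]].
right; exists i, j, l, m; split=> //; last by rewrite andbA.
by apply/ltP/Nat.ltb_lt.
Qed.

Fixpoint pq_positive (phi : lform) : bool :=
  match phi with
  | Var (vp _ _) | Var (vq _ _) | Top | Bot => true
  | Var _ | Imp _ _ => false
  | And a b | Or a b => pq_positive a && pq_positive b
  end.

Lemma pq_positive_sub phi psi : pq_positive phi -> In psi (subformulas phi) -> pq_positive psi.
Proof.
elim: phi => [p|||a IHa b IHb|a IHa b IHb|a _ b _] //= H; try by case=> [<-|[]].
- by case/andP: (H) => ha hb [<- //|/in_app_iff [/(IHa ha)|/(IHb hb)]].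
- by case/andP: (H) => ha hb [<- //|/in_app_iff [/(IHa ha)|/(IHb hb)]].
Qed.

Lemma mid_eval_pq_positive dm tv (v w : var -> bool) phi : pq_positive phi ->
  (forall i j, v (vp i j) = w (vp i j)) -> (forall i j, v (vq i j) = w (vq i j)) ->
  mid_eval dm tv v phi = top_eval w phi.
Proof.
move=> + vwp vwq; elim: phi => //= [[]|a IHa b IHb|a IHa b IHb] //.
- by case/andP => /IHa -> /IHb ->.
- by case/andP => /IHa -> /IHb ->.
Qed.

Lemma top_eval_pq_positive_mono (v w : var -> bool) phi : pq_positive phi ->
  (forall x, v x -> w x) -> top_eval v phi -> top_eval w phi.
Proof.
move=> + vw; elim: phi => //= [p _ /vw //|a IHa b IHb|a IHa b IHb] /andP [/IHa ha /IHb hb].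
- by case/andP => /ha -> /hb ->.
- by case/orP => [/ha ->|/hb ->]; rewrite ?orbT.
Qed.

Lemma slash_pq_positive S w phi : pq_positive phi ->
  (forall psi, In psi (subformulas phi) -> top_eval w psi -> S psi) -> top_eval w phi -> slash S phi.
Proof.
have sub a b c : (forall psi, In psi (c :: subformulas a ++ subformulas b) -> top_eval w psi -> S psi) ->
    (forall psi, In psi (subformulas a) -> top_eval w psi -> S psi) /\
    (forall psi, In psi (subformulas b) -> top_eval w psi -> S psi).
  by move=> H; split=> psi h; apply: H; right; apply/in_app_iff; [left|right].
elim: phi => //= [p _ H wp|_ H _|a IHa b IHb|a IHa b IHb].
- by split=> //; apply: H => //; left.
- by split=> //; apply: H => //; left.
- case/andP => /IHa ha /IHb hb H Hw; split; first by apply: H => //; left.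
  by have [Ha Hb] := sub _ _ _ H; case/andP: Hw => /(ha Ha) ? /(hb Hb) ?.
- case/andP => /IHa ha /IHb hb H Hw; split; first by apply: H => //; left.
  by have [Ha Hb] := sub _ _ _ H; case/orP: Hw => [/(ha Ha)|/(hb Hb)] ?; [left|right].
Qed.

(* A graph [a] is coded by [exact_valuation a]; [upper_valuation a] lies above it and is
   monotone in [a], which makes the interpolant a monotone circuit. *)
Definition upper_valuation (a : graph) (x : var) : bool :=
  match x with vp i j => a i j | _ => true end.

Definition exact_valuation (a : graph) (x : var) : bool :=
  match x with vp i j => a i j | vq i j => ~~ a i j | _ => true end.

Lemma computes_pq_positive phi : pq_positive phi ->
  computes (List.length (subformulas phi)) [::] (fun a => top_eval (upper_valuation a) phi).
Proof.
elim: phi => [p|||a IHa b IHb|a IHa b IHb|a _ b _] //=; try by move=> _; exact: computes_const.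
- by case: p => // i j _; [exact: computes_edge|exact: computes_const].
- case/andP => /IHa ha /IHb hb; rewrite length_app plusE.
  exact: (computes_and ha hb).
- case/andP => /IHa ha /IHb hb; rewrite length_app plusE.
  exact: (computes_or ha hb).
Qed.

Lemma length_subformulas_sub phi psi : In psi (subformulas phi) ->
  List.length (subformulas psi) <= List.length (subformulas phi).
Proof.
elim: phi => [p|||a IHa b IHb|a IHa b IHb|a IHa b IHb] /=; try by case=> [<-|[]].
- by case=> [<- //|/in_app_iff [/IHa|/IHb]]; rewrite length_app; lia.
- by case=> [<- //|/in_app_iff [/IHa|/IHb]]; rewrite length_app; lia.
- by case=> [<- //|/in_app_iff [/IHa|/IHb]]; rewrite length_app; lia.
Qed.

Section Interpolation.
Variables (M : (lform -> Prop) -> lform -> Prop) (HM : super_intuitionistic M).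
Variables (dm : bool) (m : nat) (Gm : list lform) (W : nat -> lform) (T : lform).
Hypothesis (fa : fork_algebra M dm m Gm W T).
Variables (P : list rule) (c : nat).
Hypotheses (HP : forall prems concl, In (prems, concl) P -> M (lset prems) concl)
  (Pm : forall r, In r P -> List.length (rule_formulas r) < m)
  (Pc : forall r, In r P -> List.length (rule_formulas r) <= c).
Variables (pi : list lform) (Is : list inst).
Hypotheses (Is_P : forall i, In i Is -> In i.1 P)
  (Is_pi : forall earlier psi later, pi = (earlier ++ psi :: later)%list ->
        exists i, [/\ In i Is, psi = lsubst i.2 i.1.2 &
          forall c, In c i.1.1 -> In (lsubst i.2 c) earlier]).
Variables (K A B : lform).
Hypotheses (K_pos : pq_positive K) (KAB : In (Imp K (Or A B)) pi).

Let R := closure_rules dm Is.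
Let upper_init (a : graph) (psi : lform) : bool :=
  (psi \in subformulas K) && top_eval (upper_valuation a) psi.
Let exact_init (a : graph) (psi : lform) : bool :=
  (psi \in subformulas K) && top_eval (exact_valuation a) psi.

Lemma line_slashed (a : graph) psi : In psi pi -> slash (horn R (exact_init a)) psi.
Proof.
set S := horn _ _.
have S_true phi : S phi -> mid_eval dm all_true (exact_valuation a) phi.
  apply: horn_true => chi /andP [/In_mem inK Hchi].
  by rewrite (@mid_eval_pq_positive _ _ _ (exact_valuation a)) // (pq_positive_sub K_pos).
have main : forall (e l : list lform), pi = (e ++ l)%list ->
    forall chi, In chi e -> slash S chi.
  elim/rev_ind => // x e IH l E chi; rewrite -app_assoc in E.
  move=> /in_app_iff [|[<-|[]]]; first exact: IH E chi.
  have [[[pr co] si] [iIs -> Hpr]] := Is_pi E.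
  apply: (slash_rule HM fa S_true (prems := pr)) => [X d Xd HX|||psi0 /Hpr /= he].
  - by apply: (horn_step (X := X)) => //; apply/in_flat_map; exists ((pr, co), si).
  - exact: HP (Is_P iIs).
  - exact: Pm (Is_P iIs).
  - exact: IH E _ he.
exact: (main pi [::] (esym (app_nil_r pi))).
Qed.

(** A slashed implication with slashed antecedent has a slashed disjunct. For [A], membership
    survives the passage to the larger [upper_init]; for [B], the exact values of the [q] are kept,
    as refuting [beta] requires them. *)
Lemma interpolant_cases (a : graph) : top_eval (exact_valuation a) K ->
  horn R (upper_init a) A \/
  forall g, (forall i j, g (vp i j) = a i j) -> (forall i j, g (vq i j) = ~~ a i j) ->
    mid_eval dm all_true g B.
Proof.
move=> Ka; have [_ /= H] := line_slashed a KAB.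
have : slash (horn R (exact_init a)) K.
  apply: (slash_pq_positive (w := exact_valuation a)) => // psi psiK Hpsi.
  by apply: horn_init; rewrite /exact_init Hpsi andbT; exact/In_mem.
case/H => _ [/slash_in hA|/slash_in hB]; [left|right].
  apply: horn_mono hA => psi /andP [/In_mem inK Hpsi].
  apply/andP; split; first exact/In_mem.
  by apply: top_eval_pq_positive_mono Hpsi; [exact: pq_positive_sub inK|case].
move=> g gp gq; apply: horn_true hB => chi /andP [/In_mem inK Hchi].
by rewrite (@mid_eval_pq_positive _ _ _ (exact_valuation a)) // (pq_positive_sub K_pos).
Qed.

(** To agree with [upper_valuation], [g] makes every [q] true; the intended [A] contains no [q], so
    [g] can still refute it. *)
Lemma interpolant_true (a : graph) g : horn R (upper_init a) A ->
  (forall i j, g (vp i j) = a i j) -> (forall i j, g (vq i j)) -> mid_eval dm all_true g A.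
Proof.
move=> hA gp gq; apply: horn_true hA => chi /andP [/In_mem inK Hchi].
rewrite (@mid_eval_pq_positive _ _ _ (upper_valuation a)) //.
exact: pq_positive_sub inK.
Qed.

(** With [y] the bracketed sum, [horn_cost] is at most [7 * y ^ 5 + 1]: one factor each for rounds,
    nodes, rules, premises, and the search for a premise among the nodes. Doubling this gives at
    most [16 * y ^ 5]. *)
Definition interpolant_size :=
  16 * (List.length (subformulas K) + List.length Is * (2 ^ c * c) + c + 3) ^ 5.

Lemma interpolant_computable : exists fs f,
  [/\ program fs, List.In f fs, size fs <= interpolant_size &
      forall a, f a <-> horn R (upper_init a) A].
Proof.
have R_c : all (fun r : seq lform * lform => size r.1 <= c) R.
  apply/allP => r /In_mem /in_flat_map [i [iIs /in_map_iff [[X d] [<- /filter_In [/in_prod_iff [Xs _] _]]]]].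
  rewrite -[size _]/(List.length _) length_map.
  by have [_ +] := sublists_incl Xs; move=> /leq_trans; apply; apply: Pc (Is_P iIs).
have len_sub (A0 : Type) (s : list A0) : List.length (sublists s) = 2 ^ List.length s.
  by elim: s => // x s IH; rewrite /= length_app length_map IH plusE addnn expnS mul2n.
have R_size : size R <= List.length Is * (2 ^ c * c).
  rewrite /R; elim: (Is) Is_P => // i Is' IH HIs.
  rewrite /closure_rules /= -[size _]/(List.length _) length_app plusE mulSn leq_add //; last first.
    by apply: IH => j jIs; apply: HIs; right.
  rewrite /inst_rules length_map; apply: leq_trans (_ : List.length (list_prod (sublists (rule_formulas i.1)) (rule_formulas i.1)) <= _).
    by apply/leP; exact: filter_length_le.
  rewrite length_prod len_sub multE leq_mul //; last by apply: Pc; apply: HIs; left.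
  by rewrite leq_pexp2l //; apply: Pc; apply: HIs; left.
have init_z phi : phi \in subformulas K ->
    computes (List.length (subformulas K)) [::] (fun a => upper_init a phi).
  move=> phiK; apply: (@computes_ext _ _ (fun a => top_eval (upper_valuation a) phi)).
    by move=> a; rewrite /upper_init phiK.
  have inK : In phi (subformulas K) by exact/In_mem.
  apply: computes_le (length_subformulas_sub inK) _.
  exact/computes_pq_positive/(pq_positive_sub K_pos).
have [|fs [f [h1 h2 h3 h4]]] := horn_computable (init := upper_init) _ init_z R_c A.
  by move=> a phi /andP [].
exists fs, f; split=> //; apply: (leq_trans h3).
rewrite /horn_cost /interpolant_size size_cat size_map.
move: R_size; set x := List.length (subformulas K); set r := List.length Is * _ => R_size.
rewrite -/(List.length _) -[size (subformulas K)]/x.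
set s := size R in R_size *; set y := x + r + c + 3.
have y1 : x + s <= y by rewrite /y; lia.
have e1 : x + 3 <= y by rewrite /y; lia.
have e2 : s <= y by lia.
have e3 : c <= y by rewrite /y; lia.
have e4 : 3 <= y by rewrite /y; lia.
have b1 : 5 + c * (4 * (x + s) + 3) <= 6 * y ^ 2.
  apply: (@leq_trans (5 + y * (4 * y + 3))); last by nia.
  by rewrite leq_add2l leq_mul // leq_add2r leq_mul2l y1.
have b2 : x + 3 + s * (5 + c * (4 * (x + s) + 3)) <= 7 * y ^ 3.
  apply: (@leq_trans (y + y * (6 * y ^ 2))); first by rewrite leq_add // leq_mul.
  by nia.
have b3 : (x + s) * ((x + s) * (x + 3 + s * (5 + c * (4 * (x + s) + 3)))) <= 7 * y ^ 5.
  apply: (@leq_trans (y * (y * (7 * y ^ 3)))); first by rewrite !leq_mul.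
  by rewrite !expnS; lia.
have : 0 < y ^ 5 by rewrite expn_gt0; lia.
lia.
Qed.

End Interpolation.

(** * The lower bound for extended Frege proofs *)

Lemma length_subformulas_band s z : (forall phi, In phi s -> List.length (subformulas phi) <= z) ->
  List.length (subformulas (band s)) <= (List.length s * z.+1).+1.
Proof.
elim: s => [|x [|y s] IH] // H; first by rewrite [band _]/=; have := H x (or_introl erefl); rewrite /=; lia.
rewrite [band _]/= [subformulas _]/= [List.length (_ :: _)]/= length_app plusE.
have := H x (or_introl erefl).
have := IH (fun phi h => H phi (or_intror h)); rewrite -/(band (y :: s)).
set t := List.length (y :: s).
rewrite -[List.length (x :: _)]/(t.+1) mulSn; lia.
Qed.

Definition pq_choices n : lform :=
  tr (fus_big (List.map (fun '(i, j) => choice (vp i j) (vq i j)) (pairs n n))).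

Lemma pq_choices_positive n : pq_positive (pq_choices n).
Proof.
rewrite /pq_choices tr_fus_big.
have : forall phi, In phi (List.map tr (List.map (fun '(i, j) => choice (vp i j) (vq i j)) (pairs n n))) -> pq_positive phi.
  by move=> phi /in_map_iff [psi [<- /in_map_iff [[i j] [<- _]]]].
elim: (List.map tr _) => // x [|y s] IH H; first by apply: H; left.
by apply/andP; split; [apply: H; left|apply: IH => phi h; apply: H; right].
Qed.

(** A translated [choice] has 7 subformula occurrences, and the conjunction joining it to the rest
    adds one. *)
Lemma pq_choices_length n : List.length (subformulas (pq_choices n)) <= 8 * n ^ 2 + 1.
Proof.
rewrite /pq_choices tr_fus_big; set s := List.map tr _.
have -> : 8 * n ^ 2 + 1 = (List.length s * 8).+1.
  by rewrite !length_map length_prod !length_seq multE; lia.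
by apply: length_subformulas_band => phi /in_map_iff [psi [<- /in_map_iff [[i j] [<- _]]]].
Qed.

Section LowerBound.
Variables (M : (lform -> Prop) -> lform -> Prop) (HM : super_intuitionistic M).
Variables (dm : bool) (m : nat) (Gm : list lform) (W : nat -> lform) (T : lform).
Hypothesis (fa : fork_algebra M dm m Gm W T).
Variables (P : list rule) (c : nat).
Hypotheses (HP : forall prems concl, In (prems, concl) P -> M (lset prems) concl)
  (Pm : forall r, In r P -> List.length (rule_formulas r) < m)
  (Pc : forall r, In r P -> List.length (rule_formulas r) <= c).

(** On a clique, [r] marks the vertex chosen in each block and refutes [beta], so the circuit
    accepts. On a partite graph, [s] marks the colour of each vertex and refutes [alpha], so the
    circuit rejects. *)
Lemma derivation_lower_bound n k b d pi :
  is_derivation P pi -> In (tr (Theta2 n k)) pi ->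
  (k + 1) * b <= n -> 3 <= d -> 8 * d ^ 2 <= b -> 4 * d ^ 2 <= k ->
  2 ^ d <= 16 * (8 * n ^ 2 + 1 + List.length pi * (2 ^ c * c) + c + 3) ^ 5.
Proof.
move=> /derivation_instances [Is [Isl Is_P Is_pi]] Thin kb d3 db dk.
set A := tr (SUnder (fus_big (List.map (fun '(i, l) => choice (vs i l) (vs' i l)) (pairs n k))) (alpha n k)).
set B := tr (SUnder (fus_big (List.map (fun '(i, l) => choice (vr i l) (vr' i l)) (pairs n (k + 1)))) (beta n (k + 1))).
have Thin' : In (Imp (pq_choices n) (Or A B)) pi by [].
have Kpos := pq_choices_positive n.
have [fs [f [gfs ffs sz fE]]] := interpolant_computable dm Pc Is_P A Kpos.
have : 2 ^ d <= size fs.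
  apply: (clique_colouring_lower_bound (K := k + 1) kb d3 db dk gfs ffs) => [q|col].
    have Ka : top_eval (exact_valuation (clique_graph q)) (pq_choices n).
      rewrite -(@mid_eval_pq_positive false all_true (exact_valuation (clique_graph q))) //.
      by apply: mid_eval_choices => i j _ _ /=; case: clique_graph.
    have [hA|HB] := interpolant_cases HM fa HP Pm Is_P Is_pi Kpos Thin' Ka; first exact/fE.
    pose r (i l : nat) := if @insub nat _ 'I_(k + 1) l is Some u then i == u * b + q u else false.
    pose g x := match x with
                | vp i j => clique_graph q i j | vq i j => ~~ clique_graph q i j
                | vr i l => r i l | vr' i l => ~~ r i l | _ => true end.
    have rE i l (u : 'I_(k + 1)) : nat_of_ord u = l -> r i l = (i == l * b + q u).
      by move=> <-; rewrite /r valK.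
    have /andP [/implyP Hg _] := HB g (fun _ _ => erefl) (fun _ _ => erefl).
    have /Hg /mid_eval_beta : mid_eval dm all_true g (tr (fus_big (List.map (fun '(i, l) =>
        choice (vr i l) (vr' i l)) (pairs n (k + 1))))).
      by apply: mid_eval_choices => i l _ _ /=; case: (r i l).
    case=> [[l lk Hl]|[i [j [l [l' [iN jN ll' l'k /= /and3P [ril rjl' na]]]]]]].
      pose u := Ordinal lk; have := Hl (l * b + q u); rewrite /= (rE _ _ u) // eqxx.
      suff H : l * b + q u < n by move=> /(_ H).
      apply: leq_trans kb; apply: (@leq_trans (l * b + b)); first by rewrite ltn_add2l.
      by rewrite addnC -mulSn leq_mul2r lk orbT.
    have lk : l < k + 1 by apply: ltn_trans l'k.
    move: ril rjl' na; rewrite (rE _ _ (Ordinal lk)) // (rE _ _ (Ordinal l'k)) //.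
    move=> /eqP ei /eqP ej; rewrite /clique_graph !negb_and => /or3P [|/negP []|/negP []].
    - have := ltn_ord (q (Ordinal lk)); have := ltn_ord (q (Ordinal l'k)).
      by move: ll'; rewrite ei ej; clear; nia.
    - by apply/existsP; exists (Ordinal lk); apply/eqP.
    - by apply/existsP; exists (Ordinal l'k); apply/eqP.
  apply/negP => /fE hA.
  pose s (i l : nat) := if @insub nat _ 'I_n i is Some u then nat_of_ord (col u) == l else false.
  pose g x := match x with
              | vp i j => partite_graph col i j
              | vs i l => s i l | vs' i l => ~~ s i l | _ => true end.
  have /andP [/implyP Hg _] := interpolant_true Kpos (g := g) hA (fun _ _ => erefl) (fun _ _ => erefl).
  have /Hg /mid_eval_alpha : mid_eval dm all_true g (tr (fus_big (List.map (fun '(i, l) =>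
      choice (vs i l) (vs' i l)) (pairs n k)))).
    by apply: mid_eval_choices => i l _ _ /=; case: (s i l).
  case=> [[i iN Hi]|[i [j [l [iN jN lk /= /and3P [si sj]]]]]].
    have := Hi (col (Ordinal iN)) (ltn_ord _); rewrite /= /s insubT //=.
    by rewrite eqxx.
  move: si sj; rewrite /s /partite_graph (insubT (fun i => i < n) iN) (insubT (fun i => i < n) jN) /=.
  by move=> /eqP ei /eqP ej /eqP; apply; apply/val_inj; rewrite /= ei ej.
move=> /leq_trans; apply; apply: (leq_trans sz); rewrite /interpolant_size Isl.
rewrite leq_mul2l /= leq_exp2r // !leq_add2r; exact: pq_choices_length.
Qed.

End LowerBound.

(** * Elimination of extension axioms *)

Lemma lsubst_ext (s t : var -> lform) phi : (forall x, loccurs x phi -> s x = t x) ->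
  lsubst s phi = lsubst t phi.
Proof.
elim: phi => //= [p H|a IHa b IHb H|a IHa b IHb H|a IHa b IHb H]; first exact: H.
all: by rewrite IHa 1?IHb // => x hx; apply: H; tauto.
Qed.

Lemma lsubst_id (s : var -> lform) phi : (forall x, loccurs x phi -> s x = Var x) ->
  lsubst s phi = phi.
Proof. by move=> /lsubst_ext ->; elim: phi => //= a -> b ->. Qed.

Lemma lsubst_comp (s t : var -> lform) phi :
  lsubst s (lsubst t phi) = lsubst (fun x => lsubst s (t x)) phi.
Proof. by elim: phi => //= a -> b ->. Qed.

Definition trivial_equiv : rule :=
  ([::], And (Imp (Var (vx 0)) (Var (vx 0))) (Imp (Var (vx 0)) (Var (vx 0)))).

Lemma is_derivation_rcons P pi psi : is_derivation P pi -> @by_rule Lbasic P pi psi ->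
  is_derivation P (pi ++ [:: psi])%list.
Proof.
move=> H Hpsi e chi la; elim/rev_ind: la => [|x la _].
  by move=> /(@app_inj_tail _ _ _ _ _) [<- <-].
by rewrite app_comm_cons app_assoc => /(@app_inj_tail _ _ _ _ _) [/H].
Qed.

(* Substituting the definitions for the extension variables turns extension axioms
   into instances of [trivial_equiv]. *)
Lemma eliminate_extension (P : inference_system Lbasic) phi pi :
  EF_proof P (fun _ => False) phi pi -> exists pi',
  [/\ is_derivation (trivial_equiv :: P) pi', In phi pi' & List.length pi' = List.length pi].
Proof.
move=> [[pi0 Epi] H].
suff : exists sigma, (forall x, loccurs x phi -> sigma x = Var x) /\
    is_derivation (trivial_equiv :: P) (List.map (lsubst sigma) pi).
  move=> [sigma [Hs Hd]]; exists (List.map (lsubst sigma) pi); split=> //; last by rewrite length_map.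
  rewrite Epi map_app; apply/in_app_iff; right; left; exact: lsubst_id.
clear pi0 Epi; elim/rev_ind: pi H => [|psi pi IH] H.
  by exists Var; split=> // -[].
have [|sigma [Hs Hd]] := IH.
  by move=> e chi la E; apply: (H e chi (la ++ [:: psi])%list); rewrite E -app_assoc.
have [//|[[prems [concl [s [inP [-> Hp]]]]]|[p [chi [-> [nchi [npi [_ nphi]]]]]]]] := H pi psi [::] erefl.
  exists sigma; split=> //; rewrite map_app; apply: is_derivation_rcons => //.
  exists prems, concl, (fun x => lsubst sigma (s x)); split; first by right.
  split=> [|c cp /=]; first exact: lsubst_comp.
  by rewrite -lsubst_comp; apply: in_map; exact: Hp.
(* As [p] occurs neither in the earlier lines nor in [phi], redefining it changes nothing obtained
   so far. *)
exists (fun x => if var_eq_dec x p then lsubst sigma chi else sigma x); split.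
  by move=> x hx; case: (var_eq_dec x p) => [xp|_] /=; [case: nphi; rewrite -xp|exact: Hs].
have keep c : ~ loccurs p c ->
    lsubst (fun x => if var_eq_dec x p then lsubst sigma chi else sigma x) c = lsubst sigma c.
  move=> np; apply: lsubst_ext => x hx; case: var_eq_dec => // xp.
  by case: np; rewrite -xp.
rewrite map_app (_ : List.map _ pi = List.map (lsubst sigma) pi); last first.
  by apply: map_ext_in => c cpi; apply: keep; exact: npi.
apply: is_derivation_rcons => //.
exists [::], trivial_equiv.2, (fun=> lsubst sigma chi); split; first by left.
by split=> //=; rewrite keep //; case: (var_eq_dec p p).
Qed.

(** * Choice of the parameters *)

Lemma list_bound (A : Type) (h : A -> nat) s : exists c, forall x, In x s -> h x <= c.
Proof.
elim: s => [|y s [c Hc]]; first by exists 0.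
by exists (h y + c) => x [<-|/Hc]; lia.
Qed.

(** With [q = e %/ 32], both [2 * e <= q.+1 ^ 2] and [q.+1 <= 2 ^ q] hold, so the 16th power of
    [2 * e] is at most [2 ^ (32 * q)]. The threshold [2048 = 32 * 64] is what the first inequality
    needs. *)
Lemma poly_le_exp e : 2048 <= e -> 9 * e ^ 16 <= 2 ^ e.
Proof.
move=> e0; pose q := e %/ 32.
have q1 : e < 32 * q.+1 by rewrite mulnC ltn_ceil.
have q0 : 32 * q <= e by rewrite mulnC leq_divM.
have q64 : 64 <= q.+1 by lia.
have e2 : 2 * e <= q.+1 ^ 2 by rewrite expnS expn1; nia.
apply: (@leq_trans ((2 * e) ^ 16)).
  rewrite expnMn leq_mul2r; apply/orP; right.
  by apply: (@leq_trans (2 ^ 4)) => //; rewrite leq_exp2l.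
apply: (@leq_trans ((q.+1 ^ 2) ^ 16)); first by rewrite leq_exp2r.
rewrite -expnM; apply: (@leq_trans ((2 ^ q) ^ (2 * 16))).
  by rewrite leq_exp2r // ltn_expl.
by rewrite -expnM leq_exp2l // mulnC.
Qed.

Lemma quotient_by_sqrt k n : k * k <= n -> k - 1 <= n %/ (k + 1).
Proof.
move=> h; rewrite leq_divRL ?addn1 //; apply: leq_trans h.
by case: k => // k; rewrite subn1 /=; nia.
Qed.

(** Here [e] is about [n ^ (1/8)]. With fewer than [2 ^ e] lines the circuit has at most [16 * (2 ^
    (2 * e + 1)) ^ 5 = 2 ^ (10 * e + 9)] gates: in [2 * e], one [e] counts lines and the other
    absorbs the constant [C]. The width [d = 11 * e] is chosen to exceed this exponent. *)
Theorem basic_lower_bound M : super_intuitionistic M -> infinite_branching M ->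
  forall P : inference_system Lbasic,
  (forall prems concl, In (prems, concl) P -> M (lset prems) concl) ->
  exists N, forall n pi, N <= n ->
  EF_proof P (fun _ => False) (tr (Theta n)) pi ->
  exists e, n <= e ^ 8 /\ 2 ^ e <= List.length pi.
Proof.
move=> HM inf P HP; pose P' : list rule := trivial_equiv :: P.
have HP' prems concl : In (prems, concl) P' -> M (lset prems) concl.
  case=> [[<- <-]|/HP //].
  by apply: (and_intro HM); apply: (imp_intro HM); apply: (ent_hyp HM); left.
have [c Hc] := list_bound (fun r => List.length (rule_formulas r)) P'.
(* At least [c + 1] leaves, more than the formulas of any rule. *)
have [dm [m [Gm [W [T [cm fa]]]]]] := fork_algebra_exists HM inf (ltn0Sn c).
have Hm r : In r P' -> List.length (rule_formulas r) < m by move=> /Hc h; apply: leq_trans cm.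
pose C := 2 ^ c * c; pose e0 := 2048 + c + C.
exists (e0 ^ 8).+1 => n pi nN /eliminate_extension [pi' [der Thin <-]].
have ex : exists e, n <= e ^ 8.
  by exists n; rewrite -{1}(expn1 n) leq_pexp2l //; lia.
case: (ex_minnP ex) => e ne emin; exists e; split=> //.
have : e0 < e by rewrite -(ltn_exp2r _ _ (isT : 0 < 8)); apply: leq_trans ne.
rewrite /e0 => ee0; clear nN e0.
have [pe Ce ce] : [/\ 9 * e ^ 16 <= 2 ^ e, C <= e & c + 10 <= e].
  by split; [apply: poly_le_exp; lia|lia|lia].
have ne1 : (e - 1) ^ 8 < n by rewrite ltnNge; apply/negP => /emin; lia.
rewrite leqNgt; apply/negP => Lsmall.
pose k := Nat.sqrt n; have {}Thin : In (tr (Theta2 n k)) pi' := Thin.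
have [k1 k2] : k * k <= n /\ n < k.+1 * k.+1.
  by have := Nat.sqrt_spec n (Nat.le_0_l n); rewrite -/k; lia.
clearbody k; have ke : (e - 1) ^ 4 <= k.
  rewrite -ltnS -(ltn_exp2r _ _ (isT : 0 < 2)) -expnM.
  by apply: ltn_trans ne1 _; rewrite expnS expn1.
(* [968 = 8 * 11 ^ 2] comes from the width [11 * e]; the added [1] is there because the block size
   is only known to be at least [k - 1]. *)
have k968 : 968 * e ^ 2 + 1 <= k.
  apply: leq_trans ke; have : 2047 <= e - 1 by lia.
  have : e = e - 1 + 1 by lia.
  move: (e - 1) => u -> u0.
  have -> : u ^ 4 = u * u * (u * u) by rewrite !expnS expn0 muln1 mulnA.
  have -> : (u + 1) ^ 2 = u * u + 2 * u + 1 by rewrite expnS expn1; lia.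
  have : 2047 * u <= u * u by rewrite leq_mul2r u0 orbT.
  move: (u * u) => uu h; have : 2047 * uu <= uu * uu by rewrite leq_mul2r; apply/orP; right; lia.
  lia.
have kb := quotient_by_sqrt k1.
have bk : (k + 1) * (n %/ (k + 1)) <= n by rewrite mulnC leq_divM.
move: (n %/ (k + 1)) kb bk => b kb bk.
have Hd : 2 ^ (11 * e) <= 16 * (8 * n ^ 2 + 1 + List.length pi' * C + c + 3) ^ 5.
  have dd : (11 * e) ^ 2 = 121 * e ^ 2 by rewrite expnMn.
  have [g1 g2 g3] : [/\ 3 <= 11 * e, 8 * (11 * e) ^ 2 <= b & 4 * (11 * e) ^ 2 <= k].
    by rewrite dd; move: k968 kb ce (leq_ltn_trans (leq0n _) ee0); clear; move: (e ^ 2); split; lia.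
  exact: (derivation_lower_bound HM fa HP' Hm Hc der Thin bk g1 g2 g3).
have n2 : n ^ 2 <= e ^ 16 by rewrite (expnM e 8 2) leq_exp2r.
have e16 : e <= e ^ 16 by rewrite -{1}(expn1 e) leq_pexp2l //; apply: leq_ltn_trans ee0.
have LC : List.length pi' * C <= 2 ^ e * 2 ^ e.
  by apply: leq_mul; [exact: ltnW|exact: leq_trans Ce (ltnW (ltn_expl _ _))].
have e1 : 1 <= 2 ^ e by rewrite expn_gt0.
have sum : 8 * n ^ 2 + 1 + List.length pi' * C + c + 3 <= 2 ^ (2 * e + 1).
  rewrite expnD mul2n -addnn expnD expn1.
  move: (2 ^ e) (n ^ 2) (e ^ 16) (_ * C) pe n2 e16 LC e1 ce; clear; nia.
have : 2 ^ (11 * e) <= 2 ^ (10 * e + 9).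
  apply: (leq_trans Hd); apply: (@leq_trans (2 ^ 4 * (2 ^ (2 * e + 1)) ^ 5)).
    by rewrite leq_mul // leq_exp2r.
  by rewrite -expnM -expnD leq_exp2l // mulnDl mulnAC addnC -addnA.
rewrite leq_exp2l //; move: ce; clear; lia.
Qed.

(** * The substructural case *)

Lemma tr_subst sigma phi : tr (ssubst sigma phi) = lsubst (fun x => tr (sigma x)) (tr phi).
Proof. by elim: phi => //= [a -> b ->|a -> b ->|a -> b ->|a -> b ->|a -> b ->]. Qed.

Lemma tr_occurs p phi : loccurs p (tr phi) <-> soccurs p phi.
Proof. by elim: phi => //= [a IHa b IHb|a IHa b IHb|a IHa b IHb|a IHa b IHb|a IHa b IHb]; tauto. Qed.

(** Instead of a translated sequent, the induction speaks of all contexts [H] entailing the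
    translated antecedent. Order and multiplicity of formulas then disappear at once, and fusion is
    handled as conjunction. *)
Lemma FL_sound M (X : sform -> Prop) G D H : super_intuitionistic M -> FL X G D ->
  (forall phi, X phi -> ent M H (tr phi)) -> (forall phi, In phi G -> ent M H (tr phi)) ->
  ent M H (if D is Some phi then tr phi else Bot).
Proof.
move=> HM d; elim: d H => {G D}.
- by move=> phi Xphi H HX _; exact: HX.
- by move=> phi H _ HG /=; apply: HG; left.
- by move=> H _ _; exact: top_intro.
- by move=> H _ HG; exact: (HG SZero (or_introl erefl)).
- move=> G S P phi D _ IH1 _ IH2 H HX HG; apply: IH2 => // psi.
  move=> /in_app_iff [h|[<-|h]]; try by apply: HG; rewrite !in_app_iff; tauto.
  by apply: IH1 => // chi h; apply: HG; rewrite !in_app_iff; tauto.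
- move=> G S D _ IH H HX HG; apply: IH => // psi /in_app_iff h.
  by apply: HG; rewrite in_app_iff /=; tauto.
- by move=> G _ IH H HX HG; exact: IH.
- move=> G S phi psi D _ IH H HX HG; apply: IH => // chi.
  move=> /in_app_iff [h|[<-|h]]; try by apply: HG; rewrite in_app_iff /=; tauto.
  apply: (@and_elim1 _ HM _ _ (tr psi)); apply: (HG (SAnd phi psi)).
  by rewrite in_app_iff /=; tauto.
- move=> G S phi psi D _ IH H HX HG; apply: IH => // chi.
  move=> /in_app_iff [h|[<-|h]]; try by apply: HG; rewrite in_app_iff /=; tauto.
  apply: (@and_elim2 _ HM _ (tr phi)); apply: (HG (SAnd phi psi)).
  by rewrite in_app_iff /=; tauto.
- by move=> G phi psi _ IH1 _ IH2 H HX HG; apply: and_intro => //; [exact: IH1|exact: IH2].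
- move=> G S phi psi D _ IH1 _ IH2 H HX HG.
  have Hor : ent M H (Or (tr phi) (tr psi)).
    by apply: (HG (SOr phi psi)); rewrite in_app_iff /=; tauto.
  have w x y : ent M H y -> ent M (x :: H) y by apply: ent_weak => // z; right.
  apply: (or_elim HM) Hor _ _; [apply: IH1|apply: IH2] => chi.
  + by move=> /HX; exact: w.
  + move=> /in_app_iff [h|[<-|h]]; last 2 first.
    * by hyp.
    * by apply: w; apply: HG; rewrite in_app_iff /=; tauto.
    * by apply: w; apply: HG; rewrite in_app_iff /=; tauto.
  + by move=> /HX; exact: w.
  + move=> /in_app_iff [h|[<-|h]]; last 2 first.
    * by hyp.
    * by apply: w; apply: HG; rewrite in_app_iff /=; tauto.
    * by apply: w; apply: HG; rewrite in_app_iff /=; tauto.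
- by move=> G phi psi _ IH H HX HG; apply: or_intro1 => //; exact: IH.
- by move=> G phi psi _ IH H HX HG; apply: or_intro2 => //; exact: IH.
- move=> G S phi psi D _ IH H HX HG; apply: IH => // chi.
  have Hand : ent M H (And (tr phi) (tr psi)).
    by apply: (HG (SFus phi psi)); rewrite in_app_iff /=; tauto.
  move=> /in_app_iff [h|[<-|[<-|h]]]; try by apply: HG; rewrite in_app_iff /=; tauto.
    exact: and_elim1 Hand.
  exact: and_elim2 Hand.
- move=> G S phi psi _ IH1 _ IH2 H HX HG; apply: and_intro => //.
    by apply: IH1 => // chi h; apply: HG; rewrite in_app_iff; tauto.
  by apply: IH2 => // chi h; apply: HG; rewrite in_app_iff; tauto.
- move=> G P S phi psi D _ IH1 _ IH2 H HX HG; apply: IH2 => // chi.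
  move=> /in_app_iff [h|[<-|h]]; try by apply: HG; rewrite in_app_iff /= in_app_iff; tauto.
  apply: (@imp_elim _ HM (tr phi)).
    by apply: (HG (SOver psi phi)); rewrite in_app_iff /=; tauto.
  by apply: IH1 => // x h; apply: HG; rewrite in_app_iff /= in_app_iff; tauto.
- move=> G phi psi _ IH H HX HG; apply: imp_intro => //; apply: IH.
    by move=> chi /HX; apply: ent_weak => // z; right.
  move=> chi /in_app_iff [/HG|[<-|[]]]; last by hyp.
  by apply: ent_weak => // z; right.
- move=> G P S phi psi D _ IH1 _ IH2 H HX HG; apply: IH2 => // chi.
  move=> /in_app_iff [h|[<-|h]]; try by apply: HG; rewrite in_app_iff in_app_iff /=; tauto.
  apply: (@imp_elim _ HM (tr phi)).
    by apply: (HG (SUnder phi psi)); rewrite !in_app_iff /=; tauto.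
  by apply: IH1 => // x h; apply: HG; rewrite !in_app_iff /=; tauto.
- move=> G phi psi _ IH H HX HG; apply: imp_intro => //; apply: IH.
    by move=> chi /HX; apply: ent_weak => // z; right.
  move=> chi [<-|/HG]; first by hyp.
  by apply: ent_weak => // z; right.
Qed.

Definition tr_system (P : inference_system Lstar) : inference_system Lbasic :=
  List.map (fun r => (List.map tr r.1, tr r.2)) P.

(** Both residuals become implications, so [tr] carries extension axioms to extension axioms; since
    it also preserves variable occurrences and commutes with substitution, proofs translate line by
    line. *)
Lemma tr_EF_proof (P : inference_system Lstar) phi pi :
  EF_proof P (fun _ => False) phi pi ->
  EF_proof (tr_system P) (fun _ => False) (tr phi) (List.map tr pi).
Proof.
move=> [[pi0 ->] H]; split; first by exists (List.map tr pi0); rewrite map_app.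
move=> earlier psi later E.
have [e [l [Epi [Ee El]]]] := map_eq_app _ _ _ _ E.
have [psi' [l' [El' [Epsi El'']]]] := map_eq_cons _ _ El.
subst earlier psi later l; right.
have [[]|[[prems [concl [s [inP [-> Hp]]]]]|[p [chi [-> [nchi [ne [_ nphi]]]]]]]] := H e psi' l' Epi.
  left; exists (List.map tr prems), (tr concl), (fun x => tr (s x)); split.
    by apply/in_map_iff; exists (prems, concl).
  split=> [|c /in_map_iff [d [<- /Hp h]]]; first exact: tr_subst.
  by rewrite /= -tr_subst; exact: in_map.
right; exists p, (tr chi); split=> //; split; first by move=> /tr_occurs.
split; last by split=> // /tr_occurs.
by move=> c /in_map_iff [d [<- /ne nd]] /tr_occurs.
Qed.

Lemma F_EF_proof F (P : inference_system F) X phi pi : F_proof P X phi pi -> EF_proof P X phi pi.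
Proof.
by move=> [h H]; split=> // e psi l /H [?|?]; [left|right; left].
Qed.

Lemma num_lines_length F (pi : list (form F)) : (forall phi, 1 <= fsize F phi) ->
  @num_lines F pi <= @proof_length F pi.
Proof.
move=> H; rewrite /num_lines /proof_length; elim: pi => //= x pi IH.
by rewrite plusE -add1n leq_add.
Qed.

(* Real exponents and the conclusion *)
Local Delimit Scope R_scope with RR.

Lemma exponential_le (A : Type) (prf : nat -> A -> Prop) (h : A -> nat) N :
  (forall n pi, N <= n -> prf n pi -> exists e, n <= e ^ 8 /\ 2 ^ e <= h pi) ->
  exponential prf h.
Proof.
move=> H; exists (/ 8)%RR; split; first by lra.
(* The successor makes [n] positive, as [Rpower] with base [INR n] requires. *)
exists N.+1 => n /leP nN pi /(H n pi (ltnW nN)) [e [ne eh]].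
have n0 : (0 < INR n)%RR by apply: lt_0_INR; lia.
have e0 : (0 < INR e)%RR.
  apply: lt_0_INR; apply/ltP; rewrite lt0n; apply/eqP => e0.
  by move: ne; rewrite e0 exp0n //; lia.
have INR_exp a b : INR (a ^ b) = (INR a ^ b)%RR.
  by elim: b => // b IH; rewrite expnS -multE mult_INR IH.
have step1 : (Rpower (INR n) (/ 8) <= INR e)%RR.
  apply: (@Rle_trans _ (Rpower (INR (e ^ 8)) (/ 8))).
    apply: Rle_Rpower_l; first by lra.
    by split=> //; apply: le_INR; apply/leP.
  rewrite INR_exp -Rpower_pow // Rpower_mult.
  rewrite (_ : (INR 8 * / 8 = 1)%RR); last by rewrite /=; lra.
  by rewrite Rpower_1 //; lra.
apply: (@Rle_trans _ (Rpower 2 (INR e))).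
  by apply: Rle_Rpower => //; lra.
rewrite Rpower_pow; last by lra.
rewrite (_ : (2 = INR 2)%RR) // -INR_exp; apply: le_INR; exact/leP.
Qed.

Theorem theorem5p2
  (M : (lform -> Prop) -> lform -> Prop)
  (HM : super_intuitionistic M)
  (HMinf : infinite_branching M)
  (HMfrege : has_frege M) :
  (forall L : sform -> Prop,
     substructural L ->
     (forall phi, L phi -> logic_of M (tr phi)) ->
     forall P : inference_system Lstar,
     sub_frege L P ->
     exponential (fun n => F_proof P (fun _ => False) (Theta n))
                 (@num_lines Lstar)
     /\
     exponential (fun n => EF_proof P (fun _ => False) (Theta n))
                 (@proof_length Lstar))
  /\
  (forall L : (lform -> Prop) -> lform -> Prop,
     super_basic L ->
     (forall phi, logic_of L phi -> logic_of M phi) ->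
     forall P : inference_system Lbasic,
     basic_frege_wrt L M P ->
     exponential (fun n => F_proof P (fun _ => False) (tr (Theta n)))
                 (@num_lines Lbasic)
     /\
     exponential (fun n => EF_proof P (fun _ => False) (tr (Theta n)))
                 (@proof_length Lbasic)).
Proof.
split=> [L _ LM P [_ [_ HP]]|L _ _ P [_ [_ HP]]].
  have HP' prems concl : In (prems, concl) (tr_system P) -> M (lset prems) concl.
    move=> /in_map_iff [[pr co] [[<- <-] /HP h]].
    apply: (FL_sound HM h) => // phi [phipr|/LM Lphi].
      by apply: ent_hyp => //; exact: in_map.
    exact: (@ent_weak _ HM [::]).
  have [N HN] := basic_lower_bound HM HMinf HP'.
  have lines n pi : N <= n -> EF_proof P (fun _ => False) (Theta n) pi ->
      exists e, n <= e ^ 8 /\ 2 ^ e <= @num_lines Lstar pi.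
    by move=> nN /tr_EF_proof /(HN _ _ nN) [e [h1 h2]]; exists e; rewrite length_map in h2.
  split; apply: (@exponential_le _ _ _ N) => n pi nN.
    by move=> /F_EF_proof /(lines _ _ nN).
  move=> /(lines _ _ nN) [e [h1 h2]]; exists e; split=> //; apply: leq_trans h2 _.
  by apply: num_lines_length; case.
have [N HN] := basic_lower_bound HM HMinf HP.
split; apply: (@exponential_le _ _ _ N) => n pi nN.
  by move=> /F_EF_proof /(HN _ _ nN).
move=> /(HN _ _ nN) [e [h1 h2]]; exists e; split=> //; apply: leq_trans h2 _.
by apply: num_lines_length; case.
Qed.
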